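(* Let $(S,\mathfrak m_S,k)$ and $(T,\mathfrak m_T,k)$ be commutative noetherian local rings with common residue field $k$, with $S\neq k\neq T$, and let $R:=S\times_k T$ be their fiber product over $k$. Let $M$ and $N$ be finitely generated $R$-modules. (a) If ($\operatorname{depth}(S)=0$ or $\operatorname{depth}(T)=0$) and $\operatorname{Tor}^R_i(M,N)=0$ for some $i\geq 5$, then $M$ or $N$ is free over $R$. (b) In general (with no assumption on the depths of $S$ and $T$), if $\operatorname{Tor}^R_i(M,N)=0=\operatorname{Tor}^R_{i+1}(M,N)$ for some $i\geq 5$, then $\operatorname{pd}_R(M)\leq 1$ or $\operatorname{pd}_R(N)\leq 1$.
   Context: Let $\pi_S\colon S\to k$ and $\pi_T\colon T\to k$ be the natural surjections onto the common residue field. The fiber product is $R=S\times_kT=\{(s,t)\in S\times T\mid \pi_S(s)=\pi_T(t)\}$, a commutative noetherian local ring with maximal ideal $\mathfrak m_R=\mathfrak m_S\oplus\mathfrak m_T$ and residue field $k$. The assumption $S\neq k\neq T$ means $\mathfrak m_S\neq 0$ and $\mathfrak m_T\neq 0$. $\operatorname{pd}_R$ denotes projective dimension. The zero module is free and has projective dimension $-\infty$. *)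

(* Defs.v *)
From HB Require Import structures.
From mathcomp Require Import all_boot all_algebra.
From mathcomp.finmap Require Import finmap.
From mathcomp Require Import generic_quotient ring_quotient boolp.
From mathcomp.multinomials Require Import monalg.
Set Implicit Arguments.
Unset Strict Implicit.
Unset Printing Implicit Defensive.
Import GRing.Theory.
Local Open Scope fset_scope.
Local Open Scope ring_scope.

(* Submodules are Prop-valued, so that classically every submodule is covered;
   the ideals of a ring A are the submodules of A^o. *)
Record submodule (R : nzRingType) (V : lmodType R) := Submodule {
  submodule_set :> V -> Prop;
  submodule0 : submodule_set 0;
  submoduleD : forall x y,
    submodule_set x -> submodule_set y -> submodule_set (x + y);
  submoduleZ : forall (a : R) x, submodule_set x -> submodule_set (a *: x)
}.

Section Submodules.
Context {R : nzRingType}.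
Implicit Types U V : lmodType R.

Definition full_submodule V : submodule V :=
  @Submodule R V (fun=> True) I (fun _ _ _ _ => I) (fun _ _ _ => I).

Definition submod_span V (A : V -> Prop) : submodule V.
Proof.
exists (fun x => forall W : submodule V, (forall y, A y -> W y) -> W x).
- by move=> W _; apply: submodule0.
- by move=> x y hx hy W AW; apply: submoduleD; [apply: hx|apply: hy].
- by move=> a x hx W AW; apply/submoduleZ/hx.
Defined.

Definition submod_ker U V (f : {linear U -> V}) : submodule U.
Proof.
exists (fun x => f x = 0).
- exact: linear0.
- by move=> x y fx fy; rewrite linearD fx fy addr0.
- by move=> a x fx; rewrite linearZ /= fx scaler0.
Defined.

Definition submod_im U V (f : {linear U -> V}) : submodule V.
Proof.
exists (fun y => exists x, f x = y).
- by exists 0; exact: linear0.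
- by move=> _ _ [x <-] [y <-]; exists (x + y); exact: linearD.
- by move=> a _ [x <-]; exists (a *: x); exact: linearZ.
Defined.

Definition mem_submodule V (W : submodule V) : {pred V} := fun x => `[< W x >].

Lemma mem_submoduleP V (W : submodule V) x :
  reflect (W x) (x \in mem_submodule W).
Proof. exact: asboolP. Qed.

Fact mem_submodule_closed V (W : submodule V) : submod_closed (mem_submodule W).
Proof.
split=> [|a x y /mem_submoduleP Wx /mem_submoduleP Wy].
  exact/mem_submoduleP/submodule0.
by apply/mem_submoduleP/submoduleD => //; apply: submoduleZ.
Qed.

HB.instance Definition _ V (W : submodule V) :=
  GRing.isSubmodClosed.Build R V (mem_submodule W) (mem_submodule_closed W).

Definition submod V (W : submodule V) := {x : V | x \in mem_submodule W}.

HB.instance Definition _ V (W : submodule V) := Choice.on (submod W).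
HB.instance Definition _ V (W : submodule V) := SubType.on (submod W).
HB.instance Definition _ V (W : submodule V) :=
  [SubChoice_isSubLmodule of submod W by <:].

Lemma submodP V (W : submodule V) (x : submod W) : W (val x).
Proof. exact/mem_submoduleP/valP. Qed.

Lemma submod_eq0 V (W : submodule V) (x : submod W) : val x = 0 <-> x = 0.
Proof.
have val0 : val (0 : submod W) = 0.
  exact: (raddf0 (val : {linear submod W -> V})).
by split=> [x0|->//]; apply: val_inj; rewrite x0 val0.
Qed.

Definition submod_trace V (W W' : submodule V) : submodule (submod W).
Proof.
refine (@Submodule R (submod W) (fun x => W' (val x)) _ _ _).
- by rewrite (iffRL (submod_eq0 0)) //; exact: submodule0.
- by move=> x y Wx Wy; exact: submoduleD Wx Wy.
- by move=> a x Wx; exact: submoduleZ Wx.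
Defined.

End Submodules.

Section Quotients.
Context {R : nzRingType} {V : lmodType R} (W : submodule V).
Local Open Scope quotient_scope.

Definition quotmod := Quotient.quot (mem_submodule W : zmodClosed V).
HB.instance Definition _ := GRing.Zmodule.on quotmod.
HB.instance Definition _ := EqQuotient.on quotmod.

Definition qproj (x : V) : quotmod := \pi x.

Lemma qprojP x y : qproj x = qproj y <-> W (x - y).
Proof.
rewrite /qproj; split=> [/eqP|Wxy].
  by rewrite -Quotient.idealrBE => /mem_submoduleP.
by apply/eqP; rewrite -Quotient.idealrBE; apply/mem_submoduleP.
Qed.

Lemma qprojK (q : quotmod) : qproj (repr q) = q.
Proof. exact: reprK. Qed.

Definition quotmod_scale (a : R) (q : quotmod) : quotmod := qproj (a *: repr q).

Fact quotmod_scaleE a x : quotmod_scale a (qproj x) = qproj (a *: x).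
Proof.
apply/qprojP; rewrite -scalerBr; apply: submoduleZ.
by apply/qprojP; rewrite qprojK.
Qed.

Fact quotmod_scalerA a b q :
  quotmod_scale a (quotmod_scale b q) = quotmod_scale (a * b) q.
Proof. by rewrite -(qprojK q) !quotmod_scaleE scalerA. Qed.

Fact quotmod_scale1r : left_id 1 quotmod_scale.
Proof. by move=> q; rewrite -(qprojK q) quotmod_scaleE scale1r. Qed.

Fact qprojD x y : qproj (x + y) = qproj x + qproj y.
Proof. by rewrite /qproj !piE. Qed.

Fact quotmod_scalerDr : right_distributive quotmod_scale +%R.
Proof.
move=> a p q; rewrite -(qprojK p) -(qprojK q) -qprojD !quotmod_scaleE.
by rewrite scalerDr qprojD.
Qed.

Fact quotmod_scalerDl q : {morph quotmod_scale^~ q : a b / a + b}.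
Proof.
by move=> a b; rewrite -(qprojK q) !quotmod_scaleE scalerDl qprojD.
Qed.

HB.instance Definition _ := GRing.Zmodule_isLmodule.Build R quotmod
  quotmod_scalerA quotmod_scale1r quotmod_scalerDr quotmod_scalerDl.

Fact qproj_is_linear : linear qproj.
Proof. by move=> a x y; rewrite qprojD -quotmod_scaleE. Qed.
HB.instance Definition _ := GRing.isLinear.Build R V quotmod *:%R qproj
  qproj_is_linear.

Section Lift.
Context {U : lmodType R} (f : {linear V -> U}) (f0 : forall x, W x -> f x = 0).

Definition quot_lift (q : quotmod) : U := f (repr q).

Lemma quot_liftE x : quot_lift (qproj x) = f x.
Proof.
apply/eqP; rewrite -subr_eq0 -linearB; apply/eqP/f0.
by apply/qprojP; rewrite qprojK.
Qed.
End Lift.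
End Quotients.

Arguments quotmod {R V} W.
Arguments qproj {R V} W x.

Section FreeModules.
Context {R : nzRingType} {X : choiceType} {V : lmodType R} (f : X -> V).

Definition free_lift (g : {malg R[X]}) : V :=
  \sum_(x <- msupp g) g@_x *: f x.

Lemma free_liftEw (D : {fset X}) (g : {malg R[X]}) :
  msupp g `<=` D ->
  free_lift g = \sum_(x <- D) g@_x *: f x.
Proof.
move=> gD; apply: big_fset_incl => // x _ /mcoeff_outdom ->.
by rewrite scale0r.
Qed.

Fact free_lift_is_linear : linear free_lift.
Proof.
move=> a g h; pose D := msupp g `|` msupp h.
rewrite (@free_liftEw D) ?(@free_liftEw D g) ?(@free_liftEw D h).
- rewrite scaler_sumr -big_split /=; apply: eq_bigr => x _.
  by rewrite mcoeffD mcoeffZ scalerDl scalerA.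
- exact: fsubsetUr.
- exact: fsubsetUl.
- apply: fsubset_trans (msuppD_le _ _) _.
  exact/fsetSU/msuppZ_le.
Qed.
HB.instance Definition _ := GRing.isLinear.Build R {malg R[X]} V *:%R free_lift
  free_lift_is_linear.

Lemma free_liftU x : free_lift << x >> = f x.
Proof.
rewrite (free_liftEw (msuppU_le)) big_seq_fset1 mcoeffUU.
by rewrite scale1r.
Qed.

End FreeModules.

Section ModuleProperties.
Context {R : nzRingType}.
Implicit Types M P : lmodType R.

Definition is_zero_module M := forall x : M, x = 0.

Definition fin_gen M :=
  exists s : seq M, forall x, submod_span (fun y => y \in s) x.

Definition is_free M :=
  exists (X : choiceType) (f : {linear {malg R[X]} -> M}), bijective f.

Definition is_projective P :=
  forall (A B : lmodType R) (g : {linear A -> B}) (f : {linear P -> B}),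
    (forall b, exists a, g a = b) ->
    exists h : {linear P -> A}, forall x, g (h x) = f x.

(* ... -> res_mod 1 -> res_mod 0 -> M -> 0, exact *)
Record proj_resolution M := ProjResolution {
  res_mod :> nat -> lmodType R;
  res_d : forall n, {linear res_mod n.+1 -> res_mod n};
  res_aug : {linear res_mod 0%N -> M};
  res_proj : forall n, is_projective (res_mod n);
  res_aug_surj : forall x, exists y, res_aug y = x;
  res_exact0 : forall y, res_aug y = 0 <-> exists z, res_d 0%N z = y;
  res_exactS : forall n y, res_d n y = 0 <-> exists z, res_d n.+1 z = y
}.

(* The zero module satisfies [pd_le M n] for every n, as for pd = -oo. *)
Definition pd_le M (n : nat) :=
  exists P : proj_resolution M, forall i, (n < i)%N -> is_zero_module (P i).

End ModuleProperties.

Lemma malg_projective (R : nzRingType) (X : choiceType) :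
  is_projective {malg R[X]}.
Proof.
move=> A B g f gsurj.
have /choice[u gu] : forall x : X, exists a, g a = f << x >>.
  by move=> x; apply: gsurj.
exists (free_lift u) => v; rewrite {2}[v]monalgE /free_lift !linear_sum /=.
apply: eq_bigr => x _; rewrite linearZ /= gu -linearZ /=; congr (f _).
by apply/malgP => y; rewrite mcoeffZ !mcoeffU mulrnAr mulr1.
Qed.

Section StandardResolution.
Context {R : nzRingType} (M : lmodType R).

Definition free_cover (K : lmodType R) : {linear {malg R[K]} -> K} :=
  @free_lift R K K id.

Fixpoint std_syz (n : nat) : lmodType R :=
  if n is m.+1 then submod (submod_ker (free_cover (std_syz m))) else M.

Definition std_mod (n : nat) : lmodType R := {malg R[std_syz n]}.

Definition std_d (n : nat) : {linear std_mod n.+1 -> std_mod n} :=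
  (val : {linear submod (submod_ker (free_cover (std_syz n))) -> std_mod n})
    \o free_cover (std_syz n.+1).

Fact free_cover_surj (K : lmodType R) (x : K) : exists y, free_cover K y = x.
Proof. by exists << x >>; apply: free_liftU. Qed.

Fact std_exact0 y :
  free_cover (std_syz 0) y = 0 <-> exists z, std_d 0 z = y.
Proof.
split=> [y0|[z <-]]; last exact: (submodP (free_cover (std_syz 1) z)).
have hy : y \in mem_submodule (submod_ker (free_cover (std_syz 0))).
  by apply/mem_submoduleP.
have [z zE] := @free_cover_surj (std_syz 1) (exist _ y hy).
by exists z; rewrite /= zE.
Qed.

Fact std_exactS n y : std_d n y = 0 <-> exists z, std_d n.+1 z = y.
Proof.
have dE u : std_d n u = 0 <-> free_cover (std_syz n.+1) u = 0.
  exact: (submod_eq0 (free_cover (std_syz n.+1) u)).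
split=> [/dE y0|[z <-]]; last first.
  by apply/dE; exact: (submodP (free_cover (std_syz n.+2) z)).
have hy : y \in mem_submodule (submod_ker (free_cover (std_syz n.+1))).
  by apply/mem_submoduleP.
have [z zE] := @free_cover_surj (std_syz n.+2) (exist _ y hy).
by exists z; rewrite /= zE.
Qed.

Definition std_resolution : proj_resolution M :=
  @ProjResolution R M std_mod std_d (free_cover (std_syz 0))
    (fun n => @malg_projective R (std_syz n)) (@free_cover_surj M)
    std_exact0 std_exactS.

End StandardResolution.

Section Tensor.
Context {R : comNzRingType}.
Implicit Types M N : lmodType R.

Section TensorProduct.
Context (M N : lmodType R).

Let pure (x : M) (y : N) : {malg R[(M * N)%type]} := << (x, y) >>.

Inductive tensor_rel : {malg R[(M * N)%type]} -> Prop :=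
| TensorDl x x' y : tensor_rel (pure (x + x') y - (pure x y + pure x' y))
| TensorDr x y y' : tensor_rel (pure x (y + y') - (pure x y + pure x y'))
| TensorZl a x y : tensor_rel (pure (a *: x) y - a *: pure x y)
| TensorZr a x y : tensor_rel (pure x (a *: y) - a *: pure x y).

Definition tensor : lmodType R := quotmod (submod_span tensor_rel).

Definition tens (x : M) (y : N) : tensor :=
  qproj (submod_span tensor_rel) (pure x y).

Lemma tensDl x x' y : tens (x + x') y = tens x y + tens x' y.
Proof.
rewrite /tens -linearD; apply/qprojP => W; apply; exact: TensorDl.
Qed.

Lemma tensDr x y y' : tens x (y + y') = tens x y + tens x y'.
Proof.
rewrite /tens -linearD; apply/qprojP => W; apply; exact: TensorDr.
Qed.

Lemma tensZl a x y : tens (a *: x) y = a *: tens x y.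
Proof.
rewrite /tens -linearZ; apply/qprojP => W; apply; exact: TensorZl.
Qed.

Lemma tensZr a x y : tens x (a *: y) = a *: tens x y.
Proof.
rewrite /tens -linearZ; apply/qprojP => W; apply; exact: TensorZr.
Qed.

Context (V : lmodType R) (b : {bilinear M -> N -> V}).

Let bfree : {linear {malg R[(M * N)%type]} -> V} :=
  free_lift (fun p : M * N => b p.1 p.2).

Fact bfree_rel g : submod_span tensor_rel g -> bfree g = 0.
Proof.
move=> /(_ (submod_ker bfree)); apply=> _ [x x' y|x y y'|a x y|a x y] /=.
all: rewrite linearB ?linearD ?linearZ /= !free_liftU /=.
all: rewrite ?(linearDl, linearDr, linearZl_LR, linearZr_LR) /=.
all: by rewrite ?scalerN -?opprD subrr.
Qed.

Definition tensor_lift (t : tensor) : V := quot_lift bfree t.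

Lemma tensor_liftE x y : tensor_lift (tens x y) = b x y.
Proof.
by rewrite /tensor_lift (quot_liftE bfree_rel) [LHS]free_liftU.
Qed.

Fact tensor_lift_is_linear : linear tensor_lift.
Proof.
move=> a s t; rewrite -(qprojK s) -(qprojK t) -linearP /tensor_lift.
by rewrite !(quot_liftE bfree_rel) linearP.
Qed.
HB.instance Definition _ := GRing.isLinear.Build R tensor V *:%R tensor_lift
  tensor_lift_is_linear.
End TensorProduct.

Section TensorMap.
Context (M M' N : lmodType R) (f : {linear M -> M'}).

Definition tens_comp (x : M) (y : N) : tensor M' N := tens (f x) y.

Fact tens_comp_bilinear :
  bilinear_for (GRing.Scale.Law.clone _ _ *:%R _)
    (GRing.Scale.Law.clone _ _ *:%R _) tens_comp.
Proof.
split=> [y a x x'|x a y y'] /=.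
  by rewrite /tens_comp linearP tensDl tensZl.
by rewrite /tens_comp tensDr tensZr.
Qed.
HB.instance Definition _ :=
  bilinear_isBilinear.Build R M N (tensor M' N) _ _ tens_comp
    tens_comp_bilinear.

Definition tensor_map : {linear tensor M N -> tensor M' N} :=
  tensor_lift tens_comp.

Lemma tensor_mapE x y : tensor_map (tens x y) = tens (f x) y.
Proof. exact: tensor_liftE. Qed.
End TensorMap.
End Tensor.

Section Homology.
Context {R : nzRingType} (C : nat -> lmodType R).
Context (d : forall n, {linear C n.+1 -> C n}).

Definition cycles (n : nat) : submodule (C n) :=
  if n is m.+1 return submodule (C n) then submod_ker (d m)
  else full_submodule (C 0).

Definition boundaries (n : nat) : submodule (submod (cycles n)) :=
  submod_trace (cycles n) (submod_im (d n)).

(* For n = 0 this is C 0 modulo the image of d 0. *)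
Definition homology (n : nat) : lmodType R := quotmod (boundaries n).
End Homology.

Section TorFunctor.
Context {R : comNzRingType}.

Definition Tor_of (M : lmodType R) (P : proj_resolution M) (i : nat)
    (N : lmodType R) : lmodType R :=
  homology (fun n => tensor_map N (res_d P n)) i.

(* The homology of P ⊗ N for the resolution P by the free modules on the
   elements of the successive syzygies. *)
Definition Tor (i : nat) (M N : lmodType R) : lmodType R :=
  Tor_of (std_resolution M) i N.
End TorFunctor.

Notation ideal A := (@submodule A A^o).

Section LocalRings.
Context {A : comNzRingType}.

Definition gen_ideal (s : seq A) : ideal A :=
  submod_span (V := A^o) (fun y => y \in s).

Definition noetherian :=
  forall I : ideal A, exists s : seq A, forall x, I x <-> gen_ideal s x.

Definition maximal_ideal (m : ideal A) :=
  ~ m 1 /\ forall I : ideal A, (forall x, m x -> I x) -> ~ I 1 ->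
    forall x, I x -> m x.

Definition local_ring (m : ideal A) :=
  maximal_ideal m /\
  forall n : ideal A, maximal_ideal n -> forall x, n x <-> m x.

(* pi exhibits k as the residue field A / m *)
Definition residue_map (k : fieldType) (m : ideal A) (pi : {rmorphism A -> k}) :=
  (forall c, exists x, pi x = c) /\ (forall x, pi x = 0 <-> m x).

(* s`_i is a non-zero-divisor on A / (s`_0, ..., s`_(i-1)), and (s) is proper *)
Definition regular_seq (s : seq A) :=
  (forall i, (i < size s)%N -> forall a,
     gen_ideal (take i s) (nth 0 s i * a) -> gen_ideal (take i s) a) /\
  ~ gen_ideal s 1.

(* d is the supremum of the lengths of the A-regular sequences in m *)
Definition has_depth (m : ideal A) (d : nat) :=
  (exists s, [/\ {in s, forall x, m x}, regular_seq s & size s = d]) /\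
  (forall s, {in s, forall x, m x} -> regular_seq s -> (size s <= d)%N).

End LocalRings.
Arguments noetherian A : clear implicits.

Section FiberProduct.
Context {S T : comNzRingType} {k : fieldType}.
Context (piS : {rmorphism S -> k}) (piT : {rmorphism T -> k}).

Definition fiber_pred : {pred (S * T)%type} := fun x => piS x.1 == piT x.2.

Fact fiber_pred_closed : subring_closed fiber_pred.
Proof.
split=> [|x y /eqP xE /eqP yE|x y /eqP xE /eqP yE]; rewrite unfold_in /=.
- by rewrite /fiber_pred !rmorph1.
- by rewrite /fiber_pred !rmorphB xE yE.
- by rewrite /fiber_pred !rmorphM xE yE.
Qed.

HB.instance Definition _ :=
  GRing.isSubringClosed.Build (S * T)%type fiber_pred fiber_pred_closed.

Definition fiber_product := {x : (S * T)%type | x \in fiber_pred}.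
HB.instance Definition _ := Choice.on fiber_product.
HB.instance Definition _ := SubType.on fiber_product.
HB.instance Definition _ := [SubChoice_isSubComNzRing of fiber_product by <:].
End FiberProduct.

(* Main.v *)
(* Write m_R = I + J with I = m_S, J = m_T, so that IJ = I ∩ J = 0.  If a module
   A satisfies IA ∩ JA = 0 (for instance if A is torsionless, or if J kills A),
   then the kernel K of a minimal cover F -> A is the direct sum of K ∩ IF and
   K ∩ JF.  Hence the second syzygies of M and N are direct sums of S-modules and
   T-modules, and after a shift by 4 only Tor between modules killed by I or J
   matters.  For S-modules A, A' and a T-module B, all nonzero:
   - Tor_1(A, A') <> 0: it contains e ⊗ a', where e = y e_1 for y in J, because K
     contains JF;
   - J is a direct summand of K, so Tor_(n+1)(A, -) = 0 implies Tor_n(J, -) = 0,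
     which exchanges the two sides.
   So Tor_n between modules on the same side is nonzero for n odd, and between
   modules on opposite sides for n even; two consecutive vanishings thus force a
   second syzygy to vanish.  If some s <> 0 in I is killed by I and A lies in a
   free module with coordinates in I, then s e_1 is in K and Tor_1(A, B) <> 0
   too, so one vanishing suffices, and a free syzygy inside m_R F, being killed
   by s, is zero. *)
Require Import Defs.
From HB Require Import structures.
From mathcomp Require Import all_boot all_algebra.
From mathcomp.finmap Require Import finmap.
From mathcomp Require Import boolp.
From mathcomp.multinomials Require Import monalg.
Set Implicit Arguments.
Unset Strict Implicit.
Unset Printing Implicit Defensive.
Import GRing.Theory.
Local Open Scope fset_scope.
Local Open Scope ring_scope.

(** * Tensor products of linear maps *)

Section TensorMaps.
Context {R : comNzRingType}.
Implicit Types F G K L M N U V : lmodType R.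

Lemma tensor_ind M N (P : tensor M N -> Prop) :
    P 0 -> (forall s t, P s -> P t -> P (s + t)) ->
    (forall x y, P (tens x y)) -> forall t, P t.
Proof.
move=> P0 PD Pt t; rewrite -(qprojK t) [repr t]monalgE linear_sum /=.
apply: (big_ind P) => // -[x y] _.
suff -> : << (repr t)@_(x, y) *g (x, y) >> = (repr t)@_(x, y) *: << (x, y) >>.
  by rewrite linearZ /= -/(tens x y) -tensZl.
by apply/malgP => z; rewrite mcoeffZ !mcoeffU mulrnAr mulr1.
Qed.

Lemma tensor_ext M N V (f g : {linear tensor M N -> V}) :
  (forall x y, f (tens x y) = g (tens x y)) -> forall t, f t = g t.
Proof.
move=> fg; apply: tensor_ind => // [|s t fs ft]; first by rewrite !linear0.
by rewrite !linearD fs ft.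
Qed.

Lemma tens0l M N (y : N) : tens (0 : M) y = 0.
Proof. by rewrite -(scale0r (0 : M)) tensZl scale0r. Qed.

Lemma tens0r M N (x : M) : tens x (0 : N) = 0.
Proof. by rewrite -(scale0r (0 : N)) tensZr scale0r. Qed.

Lemma tens_suml M N (I : Type) (r : seq I) (F : I -> M) (y : N) :
  tens (\sum_(i <- r) F i) y = \sum_(i <- r) tens (F i) y.
Proof.
by apply: (big_morph (fun x : M => tens x y)) => [x z|];
  rewrite ?tensDl ?tens0l.
Qed.

Section LiftOf.
Context (M N V : lmodType R) (b : M -> N -> V).
Hypothesis bP : bilinear_for (GRing.Scale.Law.clone _ _ *:%R _)
  (GRing.Scale.Law.clone _ _ *:%R _) b.

Let b' := b.
HB.instance Definition _ := bilinear_isBilinear.Build R M N V _ _ b' bP.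

Lemma tensor_lift_of :
  exists f : {linear tensor M N -> V}, forall x y, f (tens x y) = b x y.
Proof. by exists (tensor_lift b') => x y; apply: tensor_liftE. Qed.
End LiftOf.

Fact tmap_sig M M' N N' (f : {linear M -> M'}) (g : {linear N -> N'}) :
  {h : {linear tensor M N -> tensor M' N'} |
    forall x y, h (tens x y) = tens (f x) (g y)}.
Proof.
apply/cid/tensor_lift_of; split=> [y a x x'|x a y y'] /=.
  by rewrite linearP tensDl tensZl.
by rewrite linearP tensDr tensZr.
Qed.

Definition tmap M M' N N' (f : {linear M -> M'}) (g : {linear N -> N'}) :=
  sval (tmap_sig f g).

Lemma tmapE M M' N N' (f : {linear M -> M'}) (g : {linear N -> N'}) x y :
  tmap f g (tens x y) = tens (f x) (g y).
Proof. exact: (svalP (tmap_sig f g)). Qed.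

Lemma tensor_map_tmap M M' N (f : {linear M -> M'}) t :
  tensor_map N f t = tmap f idfun t.
Proof. by apply: tensor_ext t => x y; rewrite tmapE tensor_mapE. Qed.

Fact tswap_sig M N :
  {h : {linear tensor M N -> tensor N M} |
    forall x y, h (tens x y) = tens y x}.
Proof.
apply/cid.
apply: (@tensor_lift_of M N _ (fun x y => tens y x)).
split=> [y a x x'|x a y y'] /=; first by rewrite tensDr tensZr.
by rewrite tensDl tensZl.
Qed.

Definition tswap M N := sval (tswap_sig M N).

Lemma tswapE M N x y : tswap M N (tens x y) = tens y x.
Proof. exact: (svalP (tswap_sig M N)). Qed.

Lemma tswapK M N (t : tensor M N) : tswap N M (tswap M N t) = t.
Proof.
apply: (@tensor_ext _ _ _ (tswap N M \o tswap M N) idfun) t => x y /=.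
by rewrite !tswapE.
Qed.

Lemma tswap_inj0 M N (t : tensor M N) : tswap M N t = 0 -> t = 0.
Proof. by move=> t0; rewrite -[t]tswapK t0 linear0. Qed.

Lemma tmap_swap M M' N N' (f : {linear M -> M'}) (g : {linear N -> N'}) t :
  tmap g f (tswap M N t) = tswap M' N' (tmap f g t).
Proof.
apply: (@tensor_ext _ _ _ (tmap g f \o tswap M N) (tswap M' N' \o tmap f g)) t.
by move=> x y /=; rewrite tswapE !tmapE tswapE.
Qed.

Lemma tmap_comp M M' M'' N N' N'' (f : {linear M -> M'}) (g : {linear N -> N'})
    (f' : {linear M' -> M''}) (g' : {linear N' -> N''}) t :
  tmap f' g' (tmap f g t) = tmap (f' \o f) (g' \o g) t.
Proof.
apply: (@tensor_ext _ _ _ (tmap f' g' \o tmap f g)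
  (tmap (f' \o f) (g' \o g))) t.
by move=> x y /=; rewrite !tmapE.
Qed.

Lemma eq_tmap M M' N N' (f f' : {linear M -> M'}) (g g' : {linear N -> N'}) t :
  f =1 f' -> g =1 g' -> tmap f g t = tmap f' g' t.
Proof.
by move=> ff gg; apply: tensor_ext t => x y; rewrite !tmapE ff gg.
Qed.

Lemma tmap_id M N (f : {linear M -> M}) (g : {linear N -> N}) t :
  f =1 id -> g =1 id -> tmap f g t = t.
Proof.
move=> ff gg; apply: (@tensor_ext _ _ _ (tmap f g) idfun) t => x y.
by rewrite tmapE ff gg.
Qed.

(** * Right exactness of the tensor product *)

Definition inj0 M N (f : {linear M -> N}) := forall x, f x = 0 -> x = 0.
Definition surj M N (f : {linear M -> N}) := forall y, exists x, f x = y.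

Definition short_exact K F M (i : {linear K -> F}) (p : {linear F -> M}) :=
  [/\ inj0 i, surj p & forall y, p y = 0 <-> exists z, i z = y].

Lemma inj0_inj M N (f : {linear M -> N}) : inj0 f -> injective f.
Proof.
by move=> f0 x y /eqP; rewrite -subr_eq0 -linearB => /eqP/f0/subr0_eq.
Qed.

Lemma idfun_surj M : surj (idfun : {linear M -> M}).
Proof. by move=> y; exists y. Qed.

Lemma tmap_surj M M' N N' (f : {linear M -> M'}) (g : {linear N -> N'}) :
  surj f -> surj g -> surj (tmap f g).
Proof.
move=> fs gs; apply: tensor_ind => [|_ _ [x <-] [y <-]|x y].
- by exists 0; rewrite linear0.
- by exists (x + y); rewrite linearD.
- by have [u <-] := fs x; have [v <-] := gs y; exists (tens u v); rewrite tmapE.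
Qed.

(** The quotient map F ⊗ N -> (F ⊗ N) / im (K ⊗ N) factors through M ⊗ N: send x ⊗ y to the class of
    c x ⊗ y, with c x a preimage of x. So whatever dies in M ⊗ N lies in the image of K ⊗ N. *)
Lemma tmap_exactl K F M N (i : {linear K -> F}) (p : {linear F -> M}) :
    short_exact i p ->
  forall t : tensor F N, tmap p idfun t = 0 ->
    exists u : tensor K N, tmap i idfun u = t.
Proof.
case=> _ ps ex t.
pose W := submod_im (tmap i (idfun : {linear N -> N})).
have [c cK] := choice ps.
have im_ker z y : p z = 0 -> W (tens z y).
  by move=> /ex[w <-]; exists (tens w y); rewrite tmapE.
(* The chosen preimages are not linear in x, but become so modulo [W], since two preimages differ by
   an element of ker p. *)
pose b x (y : N) := qproj W (tens (c x) y).
have [|f fE] := @tensor_lift_of M N (quotmod W) b.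
  split=> [y a x x'|x a y y'] /=; rewrite /b -linearZ -linearD /=.
    apply/qprojP; rewrite -tensZl -tensDl -[X in _ - X]scale1r -scaleNr -tensZl.
    rewrite -tensDl; apply: im_ker.
    by rewrite scaleN1r linearB linearP !cK subrr.
  by rewrite tensDr tensZr.
have ft u : f (tmap p idfun u) = qproj W u.
  apply: (@tensor_ext _ _ _ (f \o tmap p idfun) (qproj W)) u => x y /=.
  rewrite tmapE fE; apply/qprojP.
  rewrite -[X in _ - X]scale1r -scaleNr -tensZl -tensDl.
  by apply: im_ker; rewrite scaleN1r linearB cK subrr.
move=> t0; have : W (t - 0) by apply/qprojP; rewrite -ft t0 !linear0.
by rewrite subr0.
Qed.

Lemma tmap_exactr K F M N (i : {linear K -> F}) (p : {linear F -> M}) :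
    short_exact i p ->
  forall t : tensor N F, tmap idfun p t = 0 ->
    exists u : tensor N K, tmap idfun i u = t.
Proof.
move=> ex t t0; have [|u uE] := tmap_exactl ex (t := tswap N F t).
  by rewrite tmap_swap t0 linear0.
by exists (tswap K N u); rewrite tmap_swap uE tswapK.
Qed.

Lemma tmap_complex K F M N N' (i : {linear K -> F}) (p : {linear F -> M})
    (g : {linear N -> N'}) t :
  short_exact i p -> tmap (p \o i) g t = 0.
Proof.
case=> _ _ ex; elim/tensor_ind: t => [|s t s0 t0|x y].
- exact: linear0.
- by rewrite linearD s0 t0 addr0.
- by rewrite tmapE /= (ex (i x)).2 ?tens0l //; exists x.
Qed.

(** * Flatness of free modules *)

Section Flat.
Context (X : choiceType).

Lemma malg_coord N (x : X) : exists c : {linear tensor {malg R[X]} N -> N},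
  forall g y, c (tens g y) = g@_x *: y.
Proof.
apply: (@tensor_lift_of {malg R[X]} N N (fun g y => g@_x *: y)).
split=> [y a g g'|g a y y'] /=.
  by rewrite mcoeffD mcoeffZ scalerDl scalerA.
by rewrite scalerDr !scalerA mulrC.
Qed.

(** An element t is determined by its coordinates [c x t] in N, and taking coordinates commutes with
    g, so injectivity can be checked coordinate by coordinate. *)
Lemma tmap_malg_inj N N' (g : {linear N -> N'}) :
  inj0 g -> inj0 (tmap (idfun : {linear {malg R[X]} -> {malg R[X]}}) g).
Proof.
move=> g0 t.
have [c cE] := choice (malg_coord N).
have [c' c'E] := choice (malg_coord N').
have [D tD] : exists D : {fset X}, t = \sum_(x <- D) tens << x >> (c x t).
  (* Allowing every larger D' lets the supports of two summands be merged in the induction. *)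
  have [D DP] : exists D : {fset X}, forall D' : {fset X}, D `<=` D' ->
      t = \sum_(x <- D') tens << x >> (c x t).
    elim/tensor_ind: t => [|s t [D sD] [E tE]|v y].
    - by exists fset0 => D' _; rewrite big1 // => x _; rewrite linear0 tens0r.
    - exists (D `|` E) => D'; rewrite fsubUset => /andP[/sD sE' /tE tE'].
      rewrite {1}sE' {1}tE' -big_split /=; apply: eq_bigr => x _.
      by rewrite linearD tensDr.
    - exists (msupp v) => D' vD'.
      rewrite {1}[v](monalgEw vD') tens_suml; apply: eq_bigr => x _.
      rewrite cE tensZr -[RHS]tensZl; congr (tens _ y).
      by apply/malgP => z; rewrite mcoeffZ !mcoeffU mulrnAr mulr1.
  by exists D; exact: DP.
move=> t0; rewrite tD big1 // => x _.
suff -> : c x t = 0 by exact: tens0r.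
apply: g0; suff gc u : g (c x u) = c' x (tmap idfun g u).
  by rewrite gc t0 linear0.
apply: (@tensor_ext _ _ _ (g \o c x) (c' x \o tmap idfun g)) u => v y /=.
by rewrite tmapE c'E cE linearZ.
Qed.
End Flat.

End TensorMaps.

(** * Vanishing of Tor *)

Section TorVanishing.
Context {R : comNzRingType}.
Implicit Types F K L M N : lmodType R.
Implicit Types X Y : choiceType.

(** Balance of Tor_1 by a diagram chase, with F and G free on X and Y. Lift u from L ⊗ M to v in L ⊗
    F; the image of v in G ⊗ F comes from z in G ⊗ K. By hypothesis z dies in N ⊗ K, so it comes
    from z' in L ⊗ K. Flatness of F makes v the image of z', and p i = 0 gives u = 0. *)
Lemma tor1_half X Y K M L N
    (i : {linear K -> {malg R[X]}}) (p : {linear {malg R[X]} -> M})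
    (j : {linear L -> {malg R[Y]}}) (q : {linear {malg R[Y]} -> N}) :
    short_exact i p -> short_exact j q ->
    inj0 (tmap i (idfun : {linear N -> N})) ->
  inj0 (tmap j (idfun : {linear M -> M})).
Proof.
move=> ip jq iN u u0.
have [ipi ips _] := ip; have [jqi jqs _] := jq.
have [v vE] := tmap_surj (@idfun_surj _ L) ips u.
have w0 : tmap idfun p (tmap j idfun v) = 0.
  by rewrite tmap_comp -[RHS]u0 -vE tmap_comp; apply: eq_tmap.
have [z zE] := tmap_exactr ip w0.
have z0 : tmap q (idfun : {linear K -> K}) z = 0.
  apply/tswap_inj0/iN; rewrite tmap_swap.
  suff -> : tmap idfun i (tmap q idfun z) = 0 by rewrite linear0.
  rewrite tmap_comp.
  rewrite (@eq_tmap _ _ _ _ _ _ (q \o idfun) _ (idfun \o i)) //.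
  by rewrite -tmap_comp zE tmap_comp (tmap_complex _ _ jq).
have [z' z'E] := tmap_exactl jq z0.
have vE' : v = tmap idfun i z'.
  apply/subr0_eq/tswap_inj0/(tmap_malg_inj (X := X) jqi); rewrite tmap_swap.
  suff -> : tmap j idfun (v - tmap idfun i z') = 0 by rewrite linear0.
  rewrite linearB -zE -z'E !tmap_comp; apply/subr0_eq.
  by rewrite subr0; apply/eqP; rewrite subr_eq0; apply/eqP/eq_tmap.
rewrite -vE vE' tmap_comp; apply: tswap_inj0.
by rewrite -tmap_swap (tmap_complex _ _ ip).
Qed.


Definition syzygy M K := exists (X : choiceType) (i : {linear K -> {malg R[X]}})
  (p : {linear {malg R[X]} -> M}), short_exact i p.

Definition std_incl M : {linear std_syz M 1 -> {malg R[M]}} := val.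

Lemma std_short_exact M : short_exact (std_incl M) (free_cover M).
Proof.
split=> [x /submod_eq0//||y]; first exact: free_cover_surj.
split=> [y0|[z <-]]; last exact: (submodP z).
have hy : y \in mem_submodule (submod_ker (free_cover M)).
  by apply/mem_submoduleP.
by exists (exist _ y hy).
Qed.

Lemma std_syzygy M n : syzygy (std_syz M n) (std_syz M n.+1).
Proof.
exists (std_syz M n), (std_incl (std_syz M n)), (free_cover (std_syz M n)).
exact: std_short_exact.
Qed.

(** Since the free cover of M is flat, Tor_1 (M, N) is the kernel of this map. *)
Definition tor1_zero M N :=
  inj0 (tmap (std_incl M) (idfun : {linear N -> N})).

(** Independence of the cover of M: balance passes to a fixed cover of N and back. *)
Lemma tor1_zeroP X M K N (i : {linear K -> {malg R[X]}})
    (p : {linear {malg R[X]} -> M}) : short_exact i p ->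
  tor1_zero M N <-> inj0 (tmap i (idfun : {linear N -> N})).
Proof.
have seN := std_short_exact N; have seM := std_short_exact M.
move=> ip; split=> [/(tor1_half seM seN)|/(tor1_half ip seN)].
  exact: (tor1_half seN ip).
exact: (tor1_half seN seM).
Qed.

Lemma tor1_zero_sym M N : tor1_zero M N -> tor1_zero N M.
Proof. exact/tor1_half/std_short_exact/std_short_exact. Qed.

Lemma tor1_zero_symE M N : tor1_zero M N <-> tor1_zero N M.
Proof. by split; apply: tor1_zero_sym. Qed.

Lemma tmap_inj0_idr Y L (j : {linear L -> {malg R[Y]}}) K F
    (i : {linear K -> F}) : inj0 i ->
  inj0 (tmap j (idfun : {linear K -> K})) <-> inj0 (tmap j i).
Proof.
move=> i0.
have jiE (u : tensor L K) : tmap j i u = tmap idfun i (tmap j idfun u).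
  by rewrite tmap_comp; apply: eq_tmap.
split=> inj u u0; apply: inj; last by rewrite jiE u0 linear0.
by apply: (tmap_malg_inj i0); rewrite -jiE.
Qed.

Lemma tmap_inj0_swap M M' N N' (f : {linear M -> M'}) (g : {linear N -> N'}) :
  inj0 (tmap f g) -> inj0 (tmap g f).
Proof.
move=> inj u u0; apply/tswap_inj0/inj.
by rewrite tmap_swap u0 linear0.
Qed.

(* Both sides say that K ⊗ L -> F ⊗ G is injective, for the free covers F of M
   and G of N. *)
Lemma tor1_zero_shift M K N L :
  syzygy M K -> syzygy N L -> tor1_zero K N <-> tor1_zero M L.
Proof.
move=> [X [i [p ip]]] [Y [j [q jq]]].
have [i0 _ _] := ip; have [j0 _ _] := jq.
rewrite (tor1_zeroP _ ip) tor1_zero_symE (tor1_zeroP _ jq).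
rewrite (tmap_inj0_idr _ i0) (tmap_inj0_idr _ j0).
by split; apply: tmap_inj0_swap.
Qed.

(* Indexing: this is the vanishing of Tor_(n+1) (M, N). *)
Definition tor_zero n M N := tor1_zero (std_syz M n) N.

Lemma tor_zero_shiftr n M N L :
  syzygy N L -> tor_zero n.+1 M N <-> tor_zero n M L.
Proof. by move=> NL; apply: tor1_zero_shift (std_syzygy M n) NL. Qed.

(** Dimension shifting trades syzygies of M for syzygies of N one at a time; k counts those left on
    M. The base case is balance of Tor_1. *)
Lemma tor_zero_sym n M N : tor_zero n M N -> tor_zero n N M.
Proof.
suff H k : tor_zero (n + k) M N -> tor1_zero (std_syz N n) (std_syz M k).
  by rewrite -{1}[n]addn0 => /H.
elim: n k => [|n IHn] k; first exact: tor1_zero_sym.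
rewrite addSnnS => /IHn.
by rewrite (tor1_zero_shift (std_syzygy N n) (std_syzygy M k)).
Qed.

Lemma tor_zero_symE n M N : tor_zero n M N <-> tor_zero n N M.
Proof. by split; apply: tor_zero_sym. Qed.

Lemma tor_zero_shiftl n M K N :
  syzygy M K -> tor_zero n.+1 M N <-> tor_zero n K N.
Proof.
by move=> MK; rewrite tor_zero_symE (tor_zero_shiftr _ _ MK) tor_zero_symE.
Qed.

Definition retract M' M := exists (i : {linear M' -> M}) (p : {linear M -> M'}),
  forall x, p (i x) = x.

Lemma tor_zero_retractr n M N N' :
  retract N' N -> tor_zero n M N -> tor_zero n M N'.
Proof.
move=> [i [p ip]] inj u u0.
suff iu : tmap idfun i u = 0.
  rewrite -(@tmap_id _ _ _ (idfun \o idfun) (p \o i) u) //.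
  by rewrite -(tmap_comp idfun i idfun p) iu linear0.
apply: inj; rewrite tmap_comp.
rewrite (@eq_tmap _ _ _ _ _ _ (idfun \o std_incl _) _ (i \o idfun)) //.
by rewrite -tmap_comp u0 linear0.
Qed.

Lemma tor_zero_retractl n M M' N :
  retract M' M -> tor_zero n M N -> tor_zero n M' N.
Proof. by move=> MM' /tor_zero_sym/(tor_zero_retractr MM')/tor_zero_sym. Qed.

Lemma homology_zero_exact (C : nat -> lmodType R)
    (d : forall n, {linear C n.+1 -> C n}) n x :
  is_zero_module (homology d n.+1) -> d n x = 0 -> exists z, d n.+1 z = x.
Proof.
move=> H0 dx; have cx : x \in mem_submodule (cycles d n.+1).
  exact/mem_submoduleP.
pose c : submod (cycles d n.+1) := exist _ x cx.
have : boundaries d n.+1 (c - 0) by apply/qprojP; rewrite linear0; apply: H0.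
by rewrite subr0.
Qed.

(** Let K be the syzygy of index n + 1. An element of K ⊗ N that dies in the free module below lifts
    to a cycle one degree up. Being a boundary, this cycle factors through the next syzygy and so
    vanishes in K ⊗ N. *)
Lemma Tor_tor_zero n M N : is_zero_module (Tor n.+1 M N) -> tor_zero n M N.
Proof.
move=> Tor0 t t0.
have seK m := std_short_exact (std_syz M m).
have [_ fc_surj _] := seK n.+1.
have [u uE] :=
  tmap_surj (g := idfun : {linear N -> N}) fc_surj (@idfun_surj _ N) t.
have dE m v : tensor_map N (std_d M m) v =
    tmap (std_incl (std_syz M m)) idfun (tmap (free_cover _) idfun v).
  by rewrite tensor_map_tmap tmap_comp; apply: eq_tmap.
have du : tensor_map N (std_d M n) u = 0 by rewrite dE uE.
have [z zE] := homology_zero_exact Tor0 du.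
by rewrite -uE -zE dE tmap_comp (tmap_complex _ _ (seK n.+1)).
Qed.

End TorVanishing.

(** * Minimal covers *)

Section FiniteGeneration.
Context {R : comNzRingType}.
Implicit Types U V : lmodType R.

Lemma submod_span_sub V (A : V -> Prop) x : A x -> submod_span A x.
Proof. by move=> Ax W; apply. Qed.

(** Bundles a function whose linearity is only established in the course of a proof. *)
Lemma linear_exists U V (f : U -> V) :
  linear f -> {g : {linear U -> V} | forall x, g x = f x}.
Proof.
move=> fL; pose f' := f.
pose H := GRing.isLinear.Build R U V *:%R f' fL.
pose g : {linear U -> V} := HB.pack f' H.
by exists g.
Qed.

Definition submodI V (W W' : submodule V) : submodule V.
Proof.
exists (fun x => W x /\ W' x).
- by split; apply: submodule0.
- by move=> x y [? ?] [? ?]; split; apply: submoduleD.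
- by move=> a x [? ?]; split; apply: submoduleZ.
Defined.

Definition submod_map U V (f : {linear U -> V}) (W : submodule U) : submodule V.
Proof.
exists (fun y => exists x, W x /\ f x = y).
- by exists 0; split; [exact: submodule0|exact: linear0].
- move=> _ _ [x [Wx <-]] [y [Wy <-]]; exists (x + y).
  by split; [exact: submoduleD|exact: linearD].
- move=> a _ [x [Wx <-]]; exists (a *: x).
  by split; [exact: submoduleZ|exact: linearZ].
Defined.

Lemma submoduleB V (W : submodule V) x y : W x -> W y -> W (x - y).
Proof.
by move=> Wx Wy; rewrite -scaleN1r; apply/submoduleD/submoduleZ.
Qed.

Definition fin_gen_submodule V (W : submodule V) := exists s : seq V,
  (forall x, x \in s -> W x) /\
  (forall x, W x -> submod_span (fun y => y \in s) x).

Lemma fin_gen_submod V (W : submodule V) :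
  fin_gen_submodule W -> fin_gen (submod W).
Proof.
move=> [s [sW Ws]]; exists (pmap insub s) => x U sU.
have [u [Uu ux]] : submod_map (val : {linear submod W -> V}) U (val x).
  apply: Ws (submodP x) _ _ => y ys.
  have yW : y \in mem_submodule W by apply/mem_submoduleP/sW.
  exists (exist _ y yW); split=> //; apply: sU.
  by rewrite mem_pmap; apply/mapP; exists y => //; rewrite insubT.
by rewrite -(val_inj ux).
Qed.

Lemma fin_gen_cover V : fin_gen V ->
  exists n (p : {linear {malg R['I_n]} -> V}), surj p.
Proof.
move=> [s sP]; exists (size s), (free_lift (fun i : 'I_(size s) => s`_i)) => x.
apply: (sP x (submod_im (free_lift (fun i : 'I_(size s) => s`_i)))) => y ys.
have iy : (index y s < size s)%N by rewrite index_mem.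
by exists << Ordinal iy >>; rewrite /= free_liftU nth_index.
Qed.

Lemma malg_coeff_linear (X : choiceType) (x : X) :
  {f : {linear {malg R[X]} -> R^o} | forall g, f g = g@_x}.
Proof.
by apply: linear_exists => a g h; rewrite mcoeffD mcoeffZ.
Qed.

Lemma malg_ordE n (g : {malg R['I_n]}) : g = \sum_i g@_i *: << i >>.
Proof.
apply/malgP => j.
rewrite raddf_sum (bigD1 j) //= big1 ?addr0 => [|i /negbTE ij].
  by rewrite mcoeffZ mcoeffUU mulr1.
by rewrite mcoeffZ mcoeffU ij mulr0.
Qed.

Lemma malg_ord_coeff n (c : 'I_n -> R) j :
  (\sum_i c i *: << i >> : {malg R['I_n]})@_j = c j.
Proof.
rewrite raddf_sum (bigD1 j) //= big1 ?addr0 => [|i /negbTE ij].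
  by rewrite mcoeffZ mcoeffUU mulr1.
by rewrite mcoeffZ mcoeffU ij mulr0.
Qed.

Lemma linear_malg_ord n V (p : {linear {malg R['I_n]} -> V}) g :
  p g = \sum_i g@_i *: p << i >>.
Proof.
by rewrite {1}[g]malg_ordE linear_sum; apply: eq_bigr => i _; rewrite linearZ.
Qed.

Hypothesis R_noeth : noetherian R.

Lemma noetherian_ideal (I : ideal R) : fin_gen_submodule I.
Proof.
have [s sP] := R_noeth I; exists s; split=> [x xs|x /sP//].
exact/sP/submod_span_sub.
Qed.

(** W is an extension of the ideal f(W) by W ∩ ker f: lifts of generators of the former and
    generators of the latter together generate W. *)
Lemma fin_gen_extension V (f : {linear V -> R^o}) (W : submodule V) :
  fin_gen_submodule (submodI W (submod_ker f)) -> fin_gen_submodule W.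
Proof.
move=> [t [tW Wt]].
have [s [sI Is]] := noetherian_ideal (submod_map f W).
have /choice[g gP] : forall y, exists x, y \in s -> W x /\ f x = y.
  move=> y; have [/sI[x xP]|] := boolP (y \in s); first by exists x.
  by exists 0.
pose u := map g s ++ t; exists u; split=> [x|x Wx].
  by rewrite mem_cat => /orP[/mapP[y /gP[Wy _] ->]//|/tW[]].
pose U := submod_span (fun y => y \in u).
have UW y : U y -> W y.
  apply=> z; rewrite mem_cat => /orP[/mapP[v /gP[Wv _] ->]//|/tW[]//].
have [y [Uy fy]] : submod_map f U (f x).
  apply: (Is (f x)); first by exists x.
  move=> y ys; have [_ fgy] := gP y ys; exists (g y); split=> //.
  by apply: submod_span_sub; rewrite mem_cat map_f.
rewrite -(subrK y x); apply: submoduleD => //.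
suff : submod_span (fun z => z \in t) (x - y).
  by apply=> z zt; apply: submod_span_sub; rewrite mem_cat zt orbT.
apply: Wt; split; first by apply: submoduleB => //; apply: UW.
by rewrite /= linearB fy subrr.
Qed.

Lemma fin_gen_malg_ord n (W : submodule {malg R['I_n]}) : fin_gen_submodule W.
Proof.
(* Induction on the number j of leading coordinates that may be nonzero; [fin_gen_extension] splits
   off the last of them. *)
suff H j (U : submodule {malg R['I_n]}) :
    (forall g i, U g -> (j <= val i)%N -> g@_i = 0) -> fin_gen_submodule U.
  by apply: (H n) => g i _; rewrite leqNgt ltn_ord.
elim: j U => [|j IHj] U U0.
  exists [::]; split=> // x Ux.
  have -> : x = 0 by apply/malgP => i; rewrite mcoeff0 (U0 x).
  exact: submodule0.
have [jn|nj] := ltnP j n; last first.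
  apply: IHj => g i Ug ji; apply: (U0 g i Ug).
  by have := leq_ltn_trans (leq_trans nj ji) (ltn_ord i); rewrite ltnn.
have [f fE] := malg_coeff_linear (Ordinal jn).
apply: (@fin_gen_extension _ f); apply: IHj => g i [Ug fg].
rewrite leq_eqVlt => /orP[/eqP ji|]; last exact: U0.
by rewrite -fg fE; congr (g@_ _); apply: val_inj.
Qed.

End FiniteGeneration.

(** * Minimal free covers and functionals into the residue field *)

Section MinimalCover.
Context {R : comNzRingType} {k : fieldType} (pi : {rmorphism R -> k}).

Definition local_at := forall r, pi r != 0 -> exists u, u * r = 1.

Hypothesis R_local : local_at.

(** Take a cover of least rank. A relation with a coefficient outside ker pi, hence a unit, would
    make the corresponding generator redundant. *)
Lemma minimal_cover (V : lmodType R) : fin_gen V ->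
  exists n (p : {linear {malg R['I_n]} -> V}),
    surj p /\ forall g, p g = 0 -> forall i, pi g@_i = 0.
Proof.
move=> /fin_gen_cover[n0 [p0 p0s]].
pose P n := `[< exists p : {linear {malg R['I_n]} -> V}, surj p >].
have exP : exists n, P n by exists n0; apply/asboolP; exists p0.
have [n /asboolP[p ps] min_n] := ex_minnP exP.
exists n, p; split=> // g pg i; apply/eqP/negPn/negP => /R_local[u ug].
case: n i p ps g pg min_n ug => [[]//|n] i p ps g pg min_n ug.
suff /min_n : P n by rewrite ltnn.
apply/asboolP; exists (free_lift (fun j => p << lift i j >>)) => x.
(* Subtracting a multiple of the relation g clears coordinate i of a preimage h of x. *)
have [h hx] := ps x; pose h' := h - (h@_i * u) *: g.
have h'i : h'@_i = 0 by rewrite mcoeffB mcoeffZ -mulrA ug mulr1 subrr.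
have <- : p h' = x by rewrite linearB linearZ /= pg scaler0 subr0.
exists (\sum_j h'@_(lift i j) *: << j >>).
rewrite linear_sum [RHS]linear_malg_ord (bigD1_ord i) //= h'i scale0r add0r.
apply: eq_bigr => j _; rewrite linearZ /=.
by rewrite free_liftU.
Qed.

(** The residue field as an R-module through pi; the separate name carries this scaling. *)
Definition resmod : Type := k.
HB.instance Definition _ := GRing.Zmodule.on resmod.

Definition resmod_scale (r : R) (c : resmod) : resmod := pi r * c.

Fact resmod_scalerA a b c :
  resmod_scale a (resmod_scale b c) = resmod_scale (a * b) c.
Proof. by rewrite /resmod_scale rmorphM mulrA. Qed.

Fact resmod_scale1r : left_id 1 resmod_scale.
Proof. by move=> c; rewrite /resmod_scale rmorph1 mul1r. Qed.

Fact resmod_scalerDr : right_distributive resmod_scale +%R.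
Proof. by move=> a b c; rewrite /resmod_scale mulrDr. Qed.

Fact resmod_scalerDl c : {morph resmod_scale^~ c : a b / a + b}.
Proof. by move=> a b; rewrite /resmod_scale rmorphD mulrDl. Qed.

HB.instance Definition _ := GRing.Zmodule_isLmodule.Build R resmod
  resmod_scalerA resmod_scale1r resmod_scalerDr resmod_scalerDl.

Lemma resmod_scaleE r (c : resmod) : r *: c = pi r * (c : k) :> k.
Proof. by []. Qed.

(** By minimality the first coordinate of a preimage, reduced by pi, does not depend on the
    preimage; hence it is linear. Its value is 1 on the image of the first basis vector. *)
Lemma residue_functional (V : lmodType R) x0 : fin_gen V -> x0 <> 0 :> V ->
  exists (phi : {linear V -> resmod}) x, phi x = 1 :> k.
Proof.
move=> /minimal_cover[n [p [ps p_min]]] x0_neq0.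
have [c cK] := choice ps.
case: n p ps p_min c cK => [|n] p ps p_min c cK.
  by case: x0_neq0; rewrite -(cK x0) linear_malg_ord big_ord0.
have [|phi phiE] := @linear_exists R V resmod (fun x => pi (c x)@_ord0).
  move=> a x y; apply/eqP; rewrite -subr_eq0 resmod_scaleE.
  rewrite -rmorphM -!rmorphD -rmorphB -mcoeffZ -mcoeffD -mcoeffB; apply/eqP.
  by apply: p_min; rewrite linearB linearP !cK subrr.
exists phi, (p << ord0 >>); rewrite phiE.
suff : pi ((c (p << ord0 >>))@_ord0 - 1) = 0.
  by rewrite rmorphB rmorph1 => /subr0_eq.
have := p_min (c (p << ord0 >>) - << ord0 >>) _ ord0.
by rewrite mcoeffB mcoeffUU; apply; rewrite linearB cK subrr.
Qed.

(* The bilinear form (x, y) |-> phi x * psi y detects v ⊗ b. *)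
Lemma tor1_nonzero n (K A B : lmodType R) (i : {linear K -> {malg R['I_n]}})
    (p : {linear {malg R['I_n]} -> A}) (phi : {linear K -> resmod})
    (psi : {linear B -> resmod}) v b :
    short_exact i p -> phi v = 1 :> k -> psi b = 1 :> k ->
    (forall j, (i v)@_j *: b = 0) ->
  ~ tor1_zero A B.
Proof.
move=> ip phiv psib vb /(tor1_zeroP _ ip) inj.
have vb0 : tens v b = 0.
  apply: inj; rewrite tmapE [i v]malg_ordE tens_suml big1 // => j _.
  by rewrite tensZl -tensZr vb tens0r.
have [|f fE] := @tensor_lift_of R K B resmod
    (fun x y => (phi x : k) * (psi y : k)).
  split=> [y a x x'|x a y y'] /=; rewrite linearP !resmod_scaleE.
    by rewrite mulrDl mulrA.
  by rewrite mulrDr !mulrA (mulrC (pi a)).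
have : f (tens v b) = 1 :> k by rewrite fE phiv psib mulr1.
by rewrite vb0 linear0 => /eqP; rewrite eq_sym oner_eq0.
Qed.

End MinimalCover.

(** * Modules over a local ring whose maximal ideal decomposes *)

Section LinearGraph.
Context {R : comNzRingType}.

(** Used for projections, whose values are only characterized by a decomposition. *)
Lemma linear_of_graph (U V : lmodType R) (G : U -> V -> Prop) :
    (forall x, exists u, G x u) -> (forall x u v, G x u -> G x v -> u = v) ->
    (forall a x y u v, G x u -> G y v -> G (a *: x + y) (a *: u + v)) ->
  exists f : {linear U -> V}, forall x, G x (f x).
Proof.
move=> /choice[f fG] Gfun Glin.
have [|g gE] := @linear_exists R U V f; last by exists g => x; rewrite gE.
by move=> a x y; apply: Gfun (fG _) _; apply: Glin.
Qed.

Lemma mem_submodule_of (V : lmodType R) (W : submodule V) x :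
  W x -> x \in mem_submodule W.
Proof. by move/mem_submoduleP. Qed.

Lemma submod_val_linear (V : lmodType R) (W : submodule V) a
  (x y : submod W) : val (a *: x + y) = a *: val x + val y.
Proof. by []. Qed.

Lemma submoduleBl (V : lmodType R) (W : submodule V) x u v :
  W (x - u) -> W (x - v) -> W (u - v).
Proof.
move=> xu xv; have -> : u - v = (x - v) - (x - u).
  by rewrite opprB [RHS]addrC addrA subrK.
exact: submoduleB.
Qed.

Lemma submodule_linear_diff (V : lmodType R) (W : submodule V) a x y u v :
  W (x - u) -> W (y - v) -> W (a *: x + y - (a *: u + v)).
Proof.
move=> xu yv; rewrite opprD addrACA -scalerBr.
by apply: submoduleD yv; apply: submoduleZ.
Qed.
End LinearGraph.

Section Decomposition.
Context {R : comNzRingType} {k : fieldType} (pi : {rmorphism R -> k}).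
Hypothesis R_local : local_at pi.
Hypothesis R_noeth : noetherian R.
Implicit Types (I J : ideal R) (A B N V : lmodType R).

Definition decomposes (I J : ideal R) := [/\
  forall r, I r -> J r -> r = 0,
  forall r, pi r = 0 -> exists a, I a /\ J (r - a),
  forall r, I r -> pi r = 0,
  forall r, J r -> pi r = 0 &
  (exists r, I r /\ r <> 0) /\ (exists r, J r /\ r <> 0)].

Lemma decomposes_sym I J : decomposes I J -> decomposes J I.
Proof.
move=> [IJ0 IJ I0 J0 [In Jn]]; split=> // r; first by move=> ? /IJ0; apply.
move=> /IJ[a [Ia Ja]]; exists (r - a); split=> //.
by rewrite opprB addrC subrK.
Qed.

Lemma ideal_mulr (I : ideal R) a r : I a -> I (a * r).
Proof. by move=> Ia; rewrite mulrC; exact: (@submoduleZ _ _ I). Qed.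

Lemma ideal_mull (I : ideal R) a r : I a -> I (r * a).
Proof. exact: (@submoduleZ _ _ I). Qed.

Lemma decomposes_mul0 I J a b : decomposes I J -> I a -> J b -> a * b = 0.
Proof.
move=> [IJ0 _ _ _ _] Ia Jb.
by apply: IJ0; [exact: ideal_mulr|exact: ideal_mull].
Qed.

Definition coeffs_in (X : choiceType) (I : ideal R) : submodule {malg R[X]}.
Proof.
exists (fun g => forall x, I g@_x).
- by move=> x; rewrite mcoeff0; apply: (@submodule0 _ _ I).
- by move=> g h Ig Ih x; rewrite mcoeffD; apply: (@submoduleD _ _ I).
- by move=> a g Ig x; rewrite mcoeffZ; apply: ideal_mull.
Defined.

Lemma coeffs_in_eq0 X I J g : decomposes I J ->
  coeffs_in X I g -> coeffs_in X J g -> g = 0.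
Proof.
by move=> [IJ0 _ _ _ _] Ig Jg; apply/malgP => x; rewrite mcoeff0; apply: IJ0.
Qed.

Lemma coeffs_decompose n I J (g : {malg R['I_n]}) : decomposes I J ->
    (forall i, pi g@_i = 0) ->
  exists a, coeffs_in _ I a /\ coeffs_in _ J (g - a).
Proof.
move=> [_ IJ _ _ _] g0; have /choice[c cP] := fun i => IJ _ (g0 i).
exists (\sum_i c i *: << i >>); split=> i; rewrite ?mcoeffB malg_ord_coeff.
  by case: (cP i).
by case: (cP i).
Qed.

Lemma coeffs_in_image n (V : lmodType R) (I : ideal R)
    (p : {linear {malg R['I_n]} -> V})
    (W : submodule V) g :
  (forall a x, I a -> W (a *: x)) -> coeffs_in _ I g -> W (p g).
Proof.
move=> IW Ig; rewrite linear_malg_ord.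
by apply: (big_ind W) => [|x y|i _];
  [exact: submodule0|exact: submoduleD|exact: IW].
Qed.

(** The retraction is the projection onto A along B: A ∩ B = 0 makes the component in A unique,
    hence linear. *)
Lemma retract_decomposition (V : lmodType R) (A B K : submodule V) :
    (forall x, A x -> K x) -> (forall x, K x -> exists a, A a /\ B (x - a)) ->
    (forall x, A x -> B x -> x = 0) ->
  exists (i : {linear submod A -> submod K})
    (p : {linear submod K -> submod A}),
    (forall x, p (i x) = x) /\ forall x, val (i x) = val x.
Proof.
move=> AK KAB AB0.
have [|i iE] := @linear_exists R (submod A) (submod K)
    (fun a => exist _ (val a) (mem_submodule_of (AK _ (submodP a)))).
  by move=> a x y; apply: val_inj.
have [|x u v xu xv|a x y u v|p pP] := @linear_of_graph R (submod K) (submod A)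
    (fun x u => B (val x - val u)).
- move=> x; have [a [Aa Ba]] := KAB _ (submodP x).
  by exists (exist _ a (mem_submodule_of Aa)).
- apply/val_inj/subr0_eq/AB0; first exact: (submodP (u - v)).
  exact: submoduleBl xu xv.
- exact: submodule_linear_diff.
exists i, p; split=> x; last by rewrite iE.
apply/val_inj/subr0_eq/AB0; first exact: (submodP (p (i x) - x)).
have := pP (i x); rewrite iE /= => Bx.
by rewrite -opprB -scaleN1r; apply: submoduleZ.
Qed.



(* As J is contained in ann I, these are R / J-modules; submodules of free
   modules with coordinates in I, and I itself, have the third property. *)
Definition sided (I : ideal R) (A : lmodType R) :=
  [/\ fin_gen A, exists x : A, x <> 0 &
    forall s, (forall r, I r -> s * r = 0) -> forall x : A, s *: x = 0].

Lemma sided_annihilated I J A : decomposes I J -> sided I A ->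
  forall r, J r -> forall x : A, r *: x = 0.
Proof.
move=> dIJ [_ _ annA] r Jr; apply: annA => a Ia.
by rewrite mulrC; exact: decomposes_mul0 dIJ Ia Jr.
Qed.

(* This says IA ∩ JA = 0. *)
Definition splits (I J : ideal R) (A : lmodType R) :=
  forall n (p : {linear {malg R['I_n]} -> A}) a b,
    coeffs_in _ I a -> coeffs_in _ J b -> p a + p b = 0 -> p a = 0.

Lemma splits_sym I J A : splits I J A -> splits J I A.
Proof.
move=> sA n p b a Jb Ia ba; have pa := sA n p a b Ia Jb.
by move: ba; rewrite addrC => ab; move: (ab); rewrite pa // add0r.
Qed.

Lemma sided_splits I J A : decomposes I J -> sided I A -> splits I J A.
Proof.
move=> dIJ pA n p a b _ Jb.
suff -> : p b = 0 by rewrite addr0.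
(* Here [submod_ker idfun] is the zero submodule. *)
apply: (@coeffs_in_image n A J p (submod_ker (idfun : {linear A -> A}))) => //.
by move=> r x Jr; exact: (sided_annihilated dIJ pA Jr).
Qed.

(** Inside a free module F, the images of IA and JA lie in IF and JF, which meet in 0. *)
Lemma torsionless_splits I J A X (i : {linear A -> {malg R[X]}}) :
  decomposes I J -> inj0 i -> splits I J A.
Proof.
move=> dIJ i0 n p a b Ia Jb pab; apply: i0; apply: (coeffs_in_eq0 dIJ).
  apply: (@coeffs_in_image n _ I (i \o p)) => // r x Ir y.
  by rewrite mcoeffZ; apply: ideal_mulr.
have -> : i (p a) = - i (p b).
  by apply/eqP; rewrite -addr_eq0 -linearD pab linear0.
rewrite -scaleN1r; apply: submoduleZ.
apply: (@coeffs_in_image n _ J (i \o p)) => // r x Jr y.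
by rewrite mcoeffZ; apply: ideal_mulr.
Qed.

Definition ker_incl (U V : lmodType R) (p : {linear U -> V}) :
  {linear submod (submod_ker p) -> U} := val.

Lemma ker_short_exact (U V : lmodType R) (p : {linear U -> V}) :
  surj p -> short_exact (ker_incl p) p.
Proof.
move=> ps; split=> // [x /submod_eq0//|y]; split=> [y0|[z <-]].
  by exists (exist _ y (mem_submodule_of (W := submod_ker p) y0)).
exact: (submodP z).
Qed.

Definition minimal n (V : lmodType R) (p : {linear {malg R['I_n]} -> V}) :=
  forall g, p g = 0 -> forall i, pi g@_i = 0.

Definition ker_in n (V : lmodType R) (p : {linear {malg R['I_n]} -> V})
  (I : ideal R) := submodI (submod_ker p) (coeffs_in _ I).

(** By minimality an element of the kernel is a sum a + b with coordinates in I and in J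
    respectively; [splits] puts a back into the kernel. *)
Lemma ker_in_retract n I J A (p : {linear {malg R['I_n]} -> A}) :
    decomposes I J -> splits I J A -> minimal p ->
  exists (i : {linear submod (ker_in p I) -> submod (submod_ker p)})
    (q : {linear submod (submod_ker p) -> submod (ker_in p I)}),
    (forall x, q (i x) = x) /\ forall x, val (i x) = val x.
Proof.
move=> dIJ sA p_min; apply: (@retract_decomposition _ _ (coeffs_in _ J)).
- by move=> x [].
- move=> x px; have [a [Ia Ja]] := coeffs_decompose dIJ (p_min x px).
  exists a; split=> //; split=> //; apply: (sA _ p a (x - a)) => //.
  by rewrite -linearD addrC subrK.
- by move=> x [_ Ix] Jx; apply: (coeffs_in_eq0 dIJ).
Qed.

Lemma fin_gen_ker_in n I A (p : {linear {malg R['I_n]} -> A}) :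
  fin_gen (submod (ker_in p I)).
Proof. exact/fin_gen_submod/fin_gen_malg_ord. Qed.

(** Projecting the kernel onto its part in IF and then to k gives a functional with value 1 at some
    v with coordinates in I. These coordinates kill B, so [tor1_nonzero] applies to v. *)
Lemma tor1_nonzero_ker_in n I J (A B : lmodType R)
    (p : {linear {malg R['I_n]} -> A}) g :
    decomposes I J -> splits I J A -> surj p -> minimal p ->
    ker_in p I g -> g <> 0 ->
    fin_gen B -> (exists b : B, b <> 0) ->
    (forall r, I r -> forall b : B, r *: b = 0) ->
  ~ tor1_zero A B.
Proof.
move=> dIJ sA ps p_min pg g0 Bfg [b0 b0_neq0] IB.
have [i [q [qi iE]]] := ker_in_retract dIJ sA p_min.
have [|phi [x phix]] := @residue_functional _ _ _ R_local _
  (exist _ g (mem_submodule_of pg) : submod (ker_in p I)) (fin_gen_ker_in I p).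
  by move=> /(congr1 val).
have [psi [b psib]] := residue_functional R_local Bfg b0_neq0.
apply: (tor1_nonzero (v := i x) (phi := phi \o q) (ker_short_exact ps) _ psib).
  by rewrite /= qi.
move=> j; apply: IB; rewrite [ker_incl p _]iE.
by have [_ Ix] := submodP x; apply: Ix.
Qed.

Lemma cover_rank_gt0 n (A : lmodType R) (p : {linear {malg R['I_n]} -> A})
    (x : A) : surj p -> x <> 0 -> (0 < n)%N.
Proof.
case: n p => [|//] p ps x0; case: x0; have [g <-] := ps x.
by rewrite linear_malg_ord big_ord0.
Qed.

Lemma scaled_gen_neq0 n (i : 'I_n) (a : R) :
  a <> 0 -> a *: << i >> <> 0 :> {malg R['I_n]}.
Proof.
move=> a0 /malgP/(_ i); rewrite mcoeffZ mcoeffUU mulr1 mcoeff0; exact: a0.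
Qed.

Lemma scaled_gen_coeffs (I : ideal R) n (i : 'I_n) (a : R) :
  I a -> coeffs_in _ I (a *: << i >> : {malg R['I_n]}).
Proof. by move=> Ia j; rewrite mcoeffZ; apply: ideal_mulr. Qed.

(** J kills both A and B: for y nonzero in J, the multiple by y of a basis vector lies in the kernel
    of the cover of A. The roles of I and J are therefore exchanged below. *)
Lemma tor1_same_side I J A B : decomposes I J -> sided I A -> sided I B ->
  ~ tor1_zero A B.
Proof.
move=> dIJ pA pB; have dJI := decomposes_sym dIJ.
have [Afg [x x0] annA] := pA; have [Bfg Bn annB] := pB.
have [n [p [ps p_min]]] := minimal_cover R_local Afg.
have [_ _ _ _ [[y [Jy y0]] _]] := dJI.
have n0 := cover_rank_gt0 ps x0.
apply: (tor1_nonzero_ker_in (g := y *: << Ordinal n0 >>) dJI _ ps p_min) => //.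
- exact/splits_sym/sided_splits.
- split; last exact: scaled_gen_coeffs.
  by rewrite /= linearZ /=; exact: sided_annihilated dIJ pA _ Jy _.
- exact: scaled_gen_neq0.
- exact: sided_annihilated dIJ pB.
Qed.

(** As s kills I it kills A, so the multiple by s of a basis vector lies in the kernel; its
    coordinates are in I, which kills B. *)
Lemma tor1_opposite_side I J A B s : decomposes I J -> sided I A -> sided J B ->
  I s -> s <> 0 -> (forall r, I r -> s * r = 0) -> ~ tor1_zero A B.
Proof.
move=> dIJ pA pB Is s0 sI; have dJI := decomposes_sym dIJ.
have [Afg [x x0] annA] := pA; have [Bfg Bn annB] := pB.
have [n [p [ps p_min]]] := minimal_cover R_local Afg.
have n0 := cover_rank_gt0 ps x0.
apply: (tor1_nonzero_ker_in (g := s *: << Ordinal n0 >>) dIJ _ ps p_min) => //.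
- exact/sided_splits.
- split; last exact: scaled_gen_coeffs.
  by rewrite /= linearZ /=; exact: annA.
- exact: scaled_gen_neq0.
- exact: sided_annihilated dJI pB.
Qed.

Lemma sided_ideal I : (exists r, I r /\ r <> 0) -> sided I (submod I).
Proof.
move=> [r [Ir r0]]; split.
- exact/fin_gen_submod/noetherian_ideal.
- by exists (exist _ (r : R^o) (mem_submodule_of Ir)) => /(congr1 val).
- by move=> s sI x; apply: val_inj; apply: (sI (val x)); exact: (submodP x).
Qed.

(** J embeds by r -> r e with e the basis vector at [i0], since J kills A. The way back takes the
    J-component of the coordinate at [i0], which lies in ker pi by minimality. *)
Lemma ideal_retract_ker n I J A (p : {linear {malg R['I_n]} -> A}) (i0 : 'I_n) :
    decomposes I J -> sided I A -> minimal p ->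
  retract (submod J) (submod (submod_ker p)).
Proof.
move=> dIJ pA p_min.
have JK (r : submod J) : submod_ker p ((val r : R) *: << i0 >>).
  by rewrite /= linearZ /=; exact: (sided_annihilated dIJ pA (submodP r)).
have [|i iE] := @linear_exists R (submod J) (submod (submod_ker p))
    (fun r => exist _ ((val r : R) *: << i0 >>) (mem_submodule_of (JK r))).
  by move=> a x y; apply: val_inj; rewrite /= scalerDl scalerA.
have [|x u v|a x y u v|q qP] :=
  @linear_of_graph R (submod (submod_ker p)) (submod J)
    (fun x u => I ((val x)@_i0 - val u)).
- move=> x; have [_ IJ _ _ _] := decomposes_sym dIJ.
  have [a [Ja Ia]] := IJ _ (p_min _ (submodP x) i0).
  by exists (exist _ (a : R^o) (mem_submodule_of Ja)).
- move=> xu xv; apply/val_inj/subr0_eq; have [IJ0 _ _ _ _] := dIJ.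
  by apply: IJ0 (submodP (u - v)); exact: submoduleBl xu xv.
- by rewrite !submod_val_linear mcoeffD mcoeffZ; exact: submodule_linear_diff.
exists i, q => r; apply/val_inj/subr0_eq; have [IJ0 _ _ _ _] := dIJ.
apply: IJ0 (submodP (q (i r) - r)).
have := qP (i r); rewrite iE /= mcoeffZ mcoeffUU mulr1 => Ir.
by rewrite -opprB -scaleN1r; apply: submoduleZ.
Qed.

(** A dimension shift to the first syzygy of A, followed by passage to its direct summand J. *)
Lemma tor_zero_descent I J A N n : decomposes I J -> sided I A ->
  tor_zero n.+1 A N -> tor_zero n (submod J) N.
Proof.
move=> dIJ pA; have [Afg [x x0] _] := pA.
have [m [p [ps p_min]]] := minimal_cover R_local Afg.
have m0 := cover_rank_gt0 ps x0.
have syz : syzygy A (submod (submod_ker p)).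
  by exists 'I_m, (ker_incl p), p; exact: ker_short_exact.
move=> /(tor_zero_shiftl _ _ syz); apply: tor_zero_retractl.
exact: (ideal_retract_ker (Ordinal m0) dIJ pA p_min).
Qed.

(** * Alternation between the two sides *)

Section Alternation.
Context (I J : ideal R) (dIJ : decomposes I J).

(** Here n stands for Tor_(n+1), as in [tor_zero], so the parities in [tor_parity] are opposite to
    those of the homological degree. *)
Let same n := (forall A B, sided I A -> sided I B -> ~ tor_zero n A B) /\
  (forall A B, sided J A -> sided J B -> ~ tor_zero n A B).
Let opposite n := forall A B, sided I A -> sided J B -> ~ tor_zero n A B.

Let sidedI : sided I (submod I).
Proof. by case: dIJ => _ _ _ _ [? _]; exact: sided_ideal. Qed.

Let sidedJ : sided J (submod J).
Proof. by case: dIJ => _ _ _ _ [_ ?]; exact: sided_ideal. Qed.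

Lemma same_side0 : same 0.
Proof.
by split=> A B; apply: tor1_same_side; [exact: dIJ|exact: decomposes_sym dIJ].
Qed.

Lemma same_sideS n : opposite n -> same n.+1.
Proof.
move=> opp; split=> A B pA pB t.
  by have /tor_zero_sym := tor_zero_descent dIJ pA t; apply: opp pB sidedJ.
by have := tor_zero_descent (decomposes_sym dIJ) pA t; apply: opp sidedI pB.
Qed.

Lemma opposite_sideS n : same n -> opposite n.+1.
Proof.
by move=> [_ sJ] A B pA pB t; have := tor_zero_descent dIJ pA t; apply: sJ sidedJ pB.
Qed.

Lemma tor_parity n : (~~ odd n -> same n) /\ (odd n -> opposite n).
Proof.
elim: n => [|n [IHs IHo]]; first by split=> // _; exact: same_side0.
by split=> /= [/negPn/IHo/same_sideS|/IHs/opposite_sideS].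
Qed.

(** The element s already gives a nonzero Tor_1 between opposite sides; the alternation then reaches
    every degree on both counts. *)
Lemma tor_socle s n : pi s = 0 -> s <> 0 -> (forall r, pi r = 0 -> s * r = 0) ->
  same n /\ opposite n.
Proof.
move=> ms s0 sm.
suff opp0 : opposite 0.
  elim: n => [|n [IHs IHo]]; first by split; [exact: same_side0|].
  by split; [exact: same_sideS|exact: opposite_sideS].
move=> A B pA pB; have [IJ0 IJ I0 J0 _] := dIJ; have dJI := decomposes_sym dIJ.
(* The I-component a of s is killed by I, because s is and JI = 0. If a = 0, then s lies in J and
   the sides are exchanged. *)
have [a [Ia Ja]] := IJ s ms.
have [a0|/eqP a0] := eqVneq a 0.
  rewrite a0 subr0 in Ja.
  move=> /tor1_zero_sym; apply: (tor1_opposite_side dJI pB pA Ja s0) => r /J0.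
  exact: sm.
apply: (tor1_opposite_side dIJ pA pB Ia a0) => r Ir.
have : s * r = 0 by exact/sm/I0.
rewrite -[s](subrK a) mulrDl [(s - a) * r]mulrC.
by rewrite (decomposes_mul0 dIJ Ir Ja) add0r.
Qed.

End Alternation.

End Decomposition.

(** * Second syzygies *)

Section LowProjectiveDimension.
Context {R : comNzRingType}.
Implicit Types K M : lmodType R.

Lemma surj_inj0_free (X : choiceType) M (p : {linear {malg R[X]} -> M}) :
  surj p -> inj0 p -> is_free M.
Proof.
move=> ps /inj0_inj p_inj; exists X, p.
have [q qK] := choice ps; exists q => // x.
by apply: p_inj; rewrite qK.
Qed.

Section TwoTermResolution.
Context (X Y : choiceType) (K M : lmodType R).
Context (i : {linear K -> {malg R[X]}}) (p : {linear {malg R[X]} -> M}).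
Context (q : {linear {malg R[Y]} -> K}).
Hypotheses (ip : short_exact i p) (q_surj : surj q) (q_inj : inj0 q).

(** The free module on [void] serves as the zero module from degree 2 on. *)
Let P (n : nat) : lmodType R :=
  match n with 0 => {malg R[X]} | 1 => {malg R[Y]} | _ => {malg R[void]} end.

Let d (n : nat) : {linear P n.+1 -> P n} :=
  match n return {linear P n.+1 -> P n} with
  | 0 => i \o q
  | 1 => free_lift (fun _ : void => (0 : {malg R[Y]}))
  | _ => free_lift (fun _ : void => (0 : {malg R[void]}))
  end.

Let malg_void (g : {malg R[void]}) : g = 0.
Proof. by apply/malgP => -[]. Qed.

Lemma pd_le1 : pd_le M 1.
Proof.
have [i0 ps ex] := ip.
have proj n : is_projective (P n) by case: n => [|[|n]]; exact: malg_projective.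
have ex0 y : p y = 0 <-> exists z, d 0 z = y.
  split=> [/ex[z <-]|[z <-]]; last by apply/ex; exists (q z).
  by have [u <-] := q_surj z; exists u.
have exS n y : d n y = 0 <-> exists z, d n.+1 z = y.
  case: n y => [|n] y.
    split=> [/i0/q_inj ->|[z <-]]; first by exists 0; rewrite linear0.
    by rewrite [z]malg_void !linear0.
  have y0 : y = 0 by case: n y => [|n] y; exact: malg_void.
  by rewrite y0; split=> _; [exists 0|]; rewrite linear0.
exists (@ProjResolution R M P d p proj ps ex0 exS) => -[|[|n]] //.
Qed.
End TwoTermResolution.
End LowProjectiveDimension.

Section SecondSyzygy.
Context {R : comNzRingType} {k : fieldType} (pi : {rmorphism R -> k}).
Hypothesis R_local : local_at pi.
Hypothesis R_noeth : noetherian R.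
Context (I J : ideal R) (dIJ : decomposes pi I J).
Implicit Types M N : lmodType R.

Definition socle_nonzero := exists s, [/\ pi s = 0, s <> 0 &
  forall r, pi r = 0 -> s * r = 0].

Lemma ker_in_sided n M (p : {linear {malg R['I_n]} -> M}) (L : ideal R) g :
  ker_in p L g -> g <> 0 -> sided L (submod (ker_in p L)).
Proof.
move=> pg g0; split.
- exact: fin_gen_ker_in.
- by exists (exist _ g (mem_submodule_of pg)) => /(congr1 val).
- move=> s sL x; apply/val_inj/malgP => j; rewrite mcoeff0 mcoeffZ.
  by apply: sL; have [_ Lx] := submodP x; exact: Lx.
Qed.

(** Let q : G -> K be a minimal cover of the first syzygy K, with kernel L. If L = 0 then K is free.
    Otherwise a nonzero g in L has a nonzero component in IG or JG. It stays in L because K is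
    torsionless, so L ∩ IG or L ∩ JG is a nonzero direct summand of L. *)
Lemma second_syzygy M : fin_gen M ->
  (pd_le M 1 /\ (socle_nonzero -> is_free M)) \/
  exists K L A,
    [/\ syzygy M K, syzygy K L, retract A L & sided I A \/ sided J A].
Proof.
move=> Mfg; have [n [p [ps p_min]]] := minimal_cover R_local Mfg.
have sep := ker_short_exact ps.
have Kfg : fin_gen (submod (submod_ker p)).
  exact/fin_gen_submod/fin_gen_malg_ord.
have [m [q [qs q_min]]] := minimal_cover R_local Kfg.
have seq := ker_short_exact qs.
have dJI := decomposes_sym dIJ; have [i0 _ _] := sep.
have sKI := torsionless_splits dIJ i0; have sKJ := torsionless_splits dJI i0.
have [q0|/existsNP[g /not_implyP[qg g0]]] := pselect (inj0 q).
  left; split; first exact: pd_le1 sep qs q0.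
  (* Minimality of p makes s kill K. If G had positive rank, s times a basis vector would be a
     nonzero element of ker q; so K = 0. *)
  move=> [s [ms s0 sm]]; apply: (surj_inj0_free ps) => x px.
  have [h hx] := qs (exist _ x (mem_submodule_of (W := submod_ker p) px)).
  case: m q qs q_min seq q0 h hx => [|m] q qs q_min seq q0 h hx.
    move/(congr1 val): hx; rewrite linear_malg_ord big_ord0 /= => <-.
    by [].
  case: (scaled_gen_neq0 (i := (ord0 : 'I_m.+1)) s0); apply: q0.
  apply/val_inj/malgP => j; rewrite linearZ /= mcoeffZ mcoeff0.
  exact/sm/p_min/(submodP (q << ord0 >>)).
right.
have [a [Ia Ja]] := coeffs_decompose dIJ (q_min g qg).
have qa : q a = 0.
  by apply: (sKI _ q a (g - a)) => //; rewrite -linearD addrC subrK.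
exists (submod (submod_ker p)), (submod (submod_ker q)).
have [a0|/eqP a0] := eqVneq a 0.
  exists (submod (ker_in q J)); split.
  - by exists 'I_n, (ker_incl p), p.
  - by exists 'I_m, (ker_incl q), q.
  - have [i [r [ri _]]] := ker_in_retract dJI sKJ q_min.
    by exists i, r.
  - right; apply: (@ker_in_sided _ _ _ _ g) => //; split=> //.
    by rewrite a0 subr0 in Ja.
exists (submod (ker_in q I)); split.
- by exists 'I_n, (ker_incl p), p.
- by exists 'I_m, (ker_incl q), q.
- have [i [r [ri _]]] := ker_in_retract dIJ sKI q_min.
  by exists i, r.
- by left; apply: (@ker_in_sided _ _ _ _ a).
Qed.

(** Two dimension shifts on each side lower the index by 4. *)
Lemma tor_zero_second_syzygy n M K L A N K' L' A' :
    syzygy M K -> syzygy K L -> retract A L ->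
    syzygy N K' -> syzygy K' L' -> retract A' L' ->
  tor_zero n.+4 M N -> tor_zero n A A'.
Proof.
move=> MK KL AL NK KL' AL' /(tor_zero_shiftl _ _ MK)/(tor_zero_shiftl _ _ KL).
move=> /(tor_zero_shiftr _ _ NK)/(tor_zero_shiftr _ _ KL').
by move=> /(tor_zero_retractl AL)/(tor_zero_retractr AL').
Qed.

Lemma tor_zero_socle n M N : socle_nonzero -> fin_gen M -> fin_gen N ->
  tor_zero n.+4 M N -> is_free M \/ is_free N.
Proof.
move=> soc /second_syzygy[[_ /(_ soc)]|[K [L [A [MK KL AL pA]]]]].
  by left.
move=> /second_syzygy[[_ /(_ soc)]|[K' [L' [A' [NK KL' AL' pA']]]]].
  by right.
move=> /(tor_zero_second_syzygy MK KL AL NK KL' AL') t.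
have [s [ms s0 sm]] := soc.
have [[sI sJ] opp] := tor_socle R_local R_noeth dIJ n ms s0 sm.
case: pA pA' => pA [] pA'.
- by case: (sI _ _ pA pA').
- by case: (opp _ _ pA pA').
- by case: (opp _ _ pA' pA); apply: tor_zero_sym.
- by case: (sJ _ _ pA pA').
Qed.

Lemma tor_zero_consecutive n M N : fin_gen M -> fin_gen N ->
  tor_zero n.+4 M N -> tor_zero n.+4.+1 M N -> pd_le M 1 \/ pd_le N 1.
Proof.
move=> /second_syzygy[[? _]|[K [L [A [MK KL AL pA]]]]]; first by left.
move=> /second_syzygy[[? _]|[K' [L' [A' [NK KL' AL' pA']]]]]; first by right.
move=> /(tor_zero_second_syzygy MK KL AL NK KL' AL') t.
move=> /(tor_zero_second_syzygy MK KL AL NK KL' AL') t'.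
(* The even one of n and n + 1 excludes A and A' on the same side, the odd one excludes opposite
   sides. *)
have [a [b [a_even b_odd ta tb]]] : exists a b,
    [/\ ~~ odd a, odd b, tor_zero a A A' & tor_zero b A A'].
  by have [?|?] := boolP (odd n); [exists n.+1, n|exists n, n.+1];
    split; rewrite //= negbK.
have [/(_ a_even)[sI sJ] _] := tor_parity R_local R_noeth dIJ a.
have [_ /(_ b_odd) opp] := tor_parity R_local R_noeth dIJ b.
case: pA pA' => pA [] pA'.
- by case: (sI _ _ pA pA').
- by case: (opp _ _ pA pA').
- by case: (opp _ _ pA' pA); apply: tor_zero_sym.
- by case: (sJ _ _ pA pA').
Qed.
End SecondSyzygy.

(** * Noetherian rings *)

Section NoetherianRings.
Context {A : comNzRingType} (A_noeth : noetherian A).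
Implicit Types (I J : ideal A) (a b x y : A).

(** Otherwise choice yields a strictly ascending chain; its union is finitely generated, so the
    generators all appear at some stage N, where the chain must stop. *)
Lemma noetherian_maximal (P : ideal A -> Prop) I0 : P I0 ->
  exists I, [/\ P I, forall x, I0 x -> I x &
    forall J, P J -> (forall x, I x -> J x) -> forall x, J x -> I x].
Proof.
move=> PI0; apply: contrapT => no_max.
pose T := {I | P I /\ forall x, I0 x -> I x}.
have /choice[next nextP] : forall t : T, exists u : T,
    (forall x, sval t x -> sval u x) /\ ~ (forall x, sval u x -> sval t x).
  move=> [I [PI I0I]]; apply: contrapT => no_next.
  apply: no_max; exists I; split=> // J PJ IJ x Jx.
  apply: contrapT => nIx; apply: no_next.
  have JP : P J /\ forall x, I0 x -> J x by split=> // z /I0I/IJ.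
  by exists (exist _ J JP); split=> //= /(_ x Jx).
have T0 : P I0 /\ forall x, I0 x -> I0 x by [].
pose u n := sval (iter n next (exist _ I0 T0)).
have uS n x : u n x -> u n.+1 x.
  by case: (nextP (iter n next (exist _ I0 T0))) => + _; apply.
have u_mono m n x : (m <= n)%N -> u m x -> u n x.
  move=> /subnKC <- ux; elim: (n - m)%N => [|j]; rewrite ?addn0 ?addnS //.
  exact: uS.
have [U UE] : exists U : ideal A, forall x, U x <-> exists n, u n x.
  have h0 : exists n, u n 0 by exists 0; exact: (submodule0 (u 0)).
  have hD x y : (exists n, u n x) -> (exists n, u n y) ->
      exists n, u n (x + y).
    move=> [m xm] [n yn]; exists (m + n)%N.
    by apply: (submoduleD (s := u _)); [apply: u_mono xm|apply: u_mono yn];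
      rewrite ?leq_addr ?leq_addl.
  have hZ c x : (exists n, u n x) -> exists n, u n (c * x).
    by move=> [n xn]; exists n; exact: (submoduleZ (s := u n)).
  by exists (@Submodule A A^o _ h0 hD hZ).
have [s sU] := A_noeth U.
have [N sN] : exists N, forall x, x \in s -> u N x.
  have : forall x, x \in s -> exists n, u n x.
    by move=> x xs; apply/UE/sU; exact: (@submod_span_sub _ A^o).
  elim: s {sU} => [|x s IHs] sn; first by exists 0.
  have [N sN] : exists N, forall x, x \in s -> u N x.
    by apply: IHs => y ys; apply: sn; rewrite inE ys orbT.
  have [n xn] := sn x (mem_head _ _); exists (n + N)%N => y.
  rewrite inE => /orP[/eqP->|/sN yN]; first exact: u_mono (leq_addr _ _) xn.
  exact: u_mono (leq_addl _ _) yN.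
have [_] := nextP (iter N next (exist _ I0 T0)); apply=> x xN.
have /sU : U x by apply/UE; exists N.+1.
by apply=> y /sN.
Qed.

(** A nonunit generates a proper ideal, which lies in one maximal among proper ideals; by uniqueness
    that one is m. *)
Lemma local_unit (m : ideal A) x :
  local_ring m -> ~ m x -> exists u, u * x = 1.
Proof.
move=> [_ m_uniq] mx; apply: contrapT => xu; apply: mx.
have [|I [I1 xI Imax]] :=
    @noetherian_maximal (fun I => ~ I 1) (gen_ideal [:: x]).
  move=> x1; apply: xu.
  have h0 : exists u, u * x = 0 by exists 0; rewrite mul0r.
  have hD y z : (exists u, u * x = y) -> (exists u, u * x = z) ->
      exists u, u * x = y + z.
    by move=> [u <-] [v <-]; exists (u + v); rewrite mulrDl.
  have hZ c y : (exists u, u * x = y) -> exists u, u * x = c * y.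
    by move=> [u <-]; exists (c * u); rewrite -mulrA.
  apply: (x1 (@Submodule A A^o _ h0 hD hZ)) => y; rewrite inE => /eqP->.
  by exists 1; rewrite mul1r.
have Im : maximal_ideal I by split=> // J IJ J1; exact: Imax.
apply/(m_uniq I Im)/xI; apply: (@submod_span_sub _ A^o); exact: mem_head.
Qed.

(** * Annihilators and zero divisors in a noetherian ring *)

Lemma gen_ideal_nil x : gen_ideal [::] x -> x = 0.
Proof. by move=> /(_ (submod_ker (idfun : {linear A^o -> A^o}))); apply. Qed.

(** The annihilators of such a are associated primes of A. *)
Definition max_annihilator a := a <> 0 /\ forall b, b <> 0 ->
  (forall x, x * a = 0 -> x * b = 0) -> forall x, x * b = 0 -> x * a = 0.

Definition annihilator a : ideal A.
Proof.
exists (fun x => x * a = 0).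
- exact: mul0r.
- by move=> x y xa ya; rewrite mulrDl xa ya addr0.
- by move=> c x xa; rewrite -mulrA xa mulr0.
Defined.

Lemma max_annihilator_exists b : b <> 0 ->
  exists a, max_annihilator a /\ forall x, x * b = 0 -> x * a = 0.
Proof.
move=> b0; have [|I [[a [a0 Ia]] bI Imax]] := @noetherian_maximal
  (fun I => exists a, a <> 0 /\ forall x, I x <-> x * a = 0) (annihilator b).
  by exists b.
exists a; split=> [|x xb]; last exact/Ia/bI.
split=> // c c0 ac x xc; apply/Ia; apply: (Imax (annihilator c)) => //.
- by exists c.
- by move=> y /Ia/ac.
Qed.

(** The annihilator of y a contains that of a, so by maximality they coincide. *)
Lemma max_annihilator_prime a x y :
  max_annihilator a -> x * a <> 0 -> y * a <> 0 -> x * y * a <> 0.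
Proof.
move=> [a0 amax] xa ya xya; apply: xa; apply: (amax _ ya).
- by move=> z za; rewrite mulrCA za mulr0.
- by rewrite mulrA.
Qed.

(** The product of the witnesses z works: it kills all of l and stays outside the annihilator of a,
    which is prime. *)
Lemma max_annihilator_avoid a (l : seq A) : max_annihilator a ->
    (forall b, b \in l -> exists z, z * b = 0 /\ z * a <> 0) ->
  exists y, y * a <> 0 /\ forall b, b \in l -> y * b = 0.
Proof.
move=> amax; elim: l => [|b l IHl] lz.
  by exists 1; rewrite mul1r; case: amax.
have [|y [ya yl]] := IHl; first by move=> c cl; apply: lz; rewrite inE cl orbT.
have [z [zb za]] := lz b (mem_head _ _).
exists (z * y); split; first exact: max_annihilator_prime.
move=> c; rewrite inE => /orP[/eqP->|/yl yc]; last by rewrite -mulrA yc mulr0.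
by rewrite mulrAC zb mul0r.
Qed.

(** Stands in for the finiteness of the set of these primes: whatever kills l kills every a with
    maximal annihilator. The list comes from the maximal condition on ideals generated by such
    lists. *)
Lemma max_annihilator_finite : exists l : seq A,
  (forall a, a \in l -> max_annihilator a) /\
  forall a, max_annihilator a -> gen_ideal l a.
Proof.
have [|I [[l [lmax Il]] _ Imax]] := @noetherian_maximal
  (fun I => exists l : seq A, (forall a, a \in l -> max_annihilator a) /\
    forall x, I x <-> gen_ideal l x) (gen_ideal [::]).
  by exists [::].
exists l; split=> // a amax; apply/Il; apply: (Imax (gen_ideal (a :: l))).
- exists (a :: l); split=> // b; rewrite inE => /orP[/eqP->//|]; exact: lmax.
- move=> x /Il; apply=> y yl; apply: (@submod_span_sub _ A^o).
  by rewrite inE yl orbT.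
- by apply: (@submod_span_sub _ A^o); exact: mem_head.
Qed.

Lemma max_annihilator_eq a b : max_annihilator b -> a <> 0 ->
  (exists x, x * a = 0 /\ x * b <> 0) -> exists z, z * b = 0 /\ z * a <> 0.
Proof.
move=> [_ bmax] a0 [x [xa xb]]; apply: contrapT => nz; apply: xb.
apply: (bmax a a0) xa => z zb; apply: contrapT => za.
by apply: nz; exists z.
Qed.

(* Prime avoidance for the finitely many maximal annihilators. *)
Lemma zero_divisor_ideal I :
    (forall x, I x -> exists a, a <> 0 /\ x * a = 0) ->
  exists a, a <> 0 /\ forall x, I x -> x * a = 0.
Proof.
move=> Izd; apply: contrapT => no_socle.
have Ia a : a <> 0 -> exists x, I x /\ x * a <> 0.
  move=> a0; apply: contrapT => nx; apply: no_socle; exists a; split=> // x Ix.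
  by apply: contrapT => xa; apply: nx; exists x.
(* If x kills the new element a, correct it by y z, where z in I does not kill a, and y kills the
   rest of the list but not a. *)
have avoid (l : seq A) : (forall a, a \in l -> max_annihilator a) ->
    exists x, I x /\ forall a, a \in l -> x * a <> 0.
  elim: l => [|a l IHl] lmax.
    by exists 0; split=> //; exact: (submodule0 I).
  have [|x [Ix xl]] := IHl.
    by move=> b bl; apply: lmax; rewrite inE bl orbT.
  have amax := lmax a (mem_head _ _).
  have [xa|xa] := pselect (x * a = 0); last first.
    exists x; split=> // b; rewrite inE => /orP[/eqP->//|]; exact: xl.
  have [y [ya yl]] : exists y, y * a <> 0 /\ forall b, b \in l -> y * b = 0.
    apply: max_annihilator_avoid => // b bl; apply: max_annihilator_eq.
    - by apply: lmax; rewrite inE bl orbT.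
    - by case: amax.
    - by exists x; split=> //; apply: xl.
  have [z [Iz za]] := Ia a (proj1 amax).
  exists (x + y * z); split.
    by apply: (submoduleD (s := I)) => //; exact: (submoduleZ (s := I)).
  move=> b; rewrite inE mulrDl => /orP[/eqP->|bl].
    by rewrite xa add0r; exact: max_annihilator_prime.
  by rewrite mulrAC yl // mul0r addr0; exact: xl.
have [l [lmax lgen]] := max_annihilator_finite.
(* This x in I kills no member of l, yet kills some c and hence some a with maximal annihilator.
   Then some y kills l but not a, contrary to the choice of l. *)
have [x [Ix xl]] := avoid l lmax.
have [c [c0 xc]] := Izd x Ix.
have [a [amax ca]] := max_annihilator_exists c0.
have [|y [ya yl]] := @max_annihilator_avoid a l amax.
  move=> b bl; apply: max_annihilator_eq; first exact: lmax.
    by case: amax.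
  by exists x; split; [exact: ca|exact: xl].
apply: ya; rewrite mulrC; apply: (lgen a amax (annihilator y)) => b bl.
by rewrite /= mulrC; exact: yl.
Qed.

(** In depth 0 every element of m is a zero divisor, so a single nonzero a is killed by m. It lies
    in m, since a unit would force m = 0. *)
Lemma depth0_socle (m : ideal A) : local_ring m -> has_depth m 0 ->
    (exists x, m x /\ x <> 0) ->
  exists a, [/\ m a, a <> 0 & forall x, m x -> x * a = 0].
Proof.
move=> m_local [_ depth0] [y [my y0]]; have [[m1 _] _] := m_local.
have [|a [a0 ma]] := @zero_divisor_ideal m; last first.
  exists a; split=> //; apply: contrapT => /(local_unit m_local)[u ua].
  apply: y0.
  by rewrite -[y]mulr1 -ua mulrCA ma ?mulr0.
move=> x mx; apply: contrapT => xreg.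
suff xr : regular_seq [:: x].
  suff : (size [:: x] <= 0)%N by [].
  by apply: depth0 => // z; rewrite inE => /eqP->.
split=> [[|//] _ a /= /gen_ideal_nil xa|x1].
  suff -> : a = 0 by exact: (submodule0 (gen_ideal [::])).
  by apply: contrapT => a0; apply: xreg; exists a.
by apply: m1; apply: (x1 m) => z; rewrite inE => /eqP->.
Qed.
End NoetherianRings.

(** * Fiber products *)

Definition ker_ideal (A B : comNzRingType) (f : {rmorphism A -> B}) : ideal A.
Proof.
exists (fun x => f x = 0).
- exact: rmorph0.
- by move=> x y fx fy; rewrite rmorphD fx fy addr0.
- by move=> a x fx; rewrite rmorphM fx mulr0.
Defined.

Section FiberProductRing.
Context {S T : comNzRingType} {k : fieldType} {mS : ideal S} {mT : ideal T}.
Context {piS : {rmorphism S -> k}} {piT : {rmorphism T -> k}}.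
Hypotheses (S_noeth : noetherian S) (T_noeth : noetherian T).
Hypotheses (S_local : local_ring mS) (T_local : local_ring mT).
Hypotheses (S_residue : residue_map mS piS) (T_residue : residue_map mT piT).
Let R := fiber_product piS piT.

Definition fib_fst : {rmorphism R -> S} := fst \o val.
Definition fib_snd : {rmorphism R -> T} := snd \o val.
Definition fib_res : {rmorphism R -> k} := piS \o fib_fst.

Lemma fib_resE r : fib_res r = piT (fib_snd r).
Proof. by apply/eqP; exact: (valP r). Qed.

Lemma fib_eq r r' : fib_fst r = fib_fst r' -> fib_snd r = fib_snd r' -> r = r'.
Proof.
rewrite /fib_fst /fib_snd /= => e1 e2; apply: val_inj.
by rewrite (surjective_pairing (val r)) e1 e2 -surjective_pairing.
Qed.

Lemma fib_pair s t : piS s = piT t ->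
  exists r, fib_fst r = s /\ fib_snd r = t.
Proof.
move=> st; have h : (s, t) \in fiber_pred piS piT by exact/eqP.
by exists (exist _ (s, t) h).
Qed.

Lemma fib_fst_surj s : exists r, fib_fst r = s.
Proof.
have [t ts] := T_residue.1 (piS s).
by have [r [rs _]] := fib_pair (esym ts); exists r.
Qed.

Lemma fib_snd_surj t : exists r, fib_snd r = t.
Proof.
have [s ts] := S_residue.1 (piT t).
by have [r [_ rs]] := fib_pair ts; exists r.
Qed.

Lemma fib_local : local_at fib_res.
Proof.
move=> r r0.
have [u us] : exists u, u * fib_fst r = 1.
  apply: (local_unit S_noeth S_local) => /S_residue.2 s0.
  by move: r0; rewrite /= s0 eqxx.
have [v vt] : exists v, v * fib_snd r = 1.
  apply: (local_unit T_noeth T_local) => /T_residue.2 t0.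
  by move: r0; rewrite fib_resE t0 eqxx.
(* The residues of u and v are both inverse to that of r, so they agree in k. *)
have [|w [ws wt]] := @fib_pair u v.
  apply: (mulIf r0); rewrite {2}fib_resE /= -!rmorphM us vt !rmorph1 //.
by exists w; apply: fib_eq; rewrite rmorphM rmorph1 ?ws ?wt.
Qed.

Lemma fib_fst_image (I : ideal R) :
  exists J : ideal S, forall x, J x <-> exists r, I r /\ fib_fst r = x.
Proof.
have h0 : exists r, I r /\ fib_fst r = 0.
  by exists 0; split; [exact: (submodule0 I)|exact: rmorph0].
have hD x y : (exists r, I r /\ fib_fst r = x) ->
    (exists r, I r /\ fib_fst r = y) -> exists r, I r /\ fib_fst r = x + y.
  move=> [r [Ir <-]] [r' [Ir' <-]]; exists (r + r').
  by split; [exact: (submoduleD (s := I))|exact: rmorphD].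
have hZ a x : (exists r, I r /\ fib_fst r = x) ->
    exists r, I r /\ fib_fst r = a * x.
  have [b <-] := fib_fst_surj a; move=> [r [Ir <-]]; exists (b * r).
  by split; [exact: (submoduleZ (s := I))|exact: rmorphM].
by exists (@Submodule S S^o _ h0 hD hZ).
Qed.

Lemma fib_snd_trace (I : ideal R) : exists J : ideal T, forall y,
  J y <-> exists r, [/\ I r, fib_fst r = 0 & fib_snd r = y].
Proof.
have h0 : exists r, [/\ I r, fib_fst r = 0 & fib_snd r = 0].
  by exists 0; split; [exact: (submodule0 I)|exact: rmorph0|exact: rmorph0].
have hD x y : (exists r, [/\ I r, fib_fst r = 0 & fib_snd r = x]) ->
    (exists r, [/\ I r, fib_fst r = 0 & fib_snd r = y]) ->
    exists r, [/\ I r, fib_fst r = 0 & fib_snd r = x + y].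
  move=> [r [Ir r0 <-]] [r' [Ir' r'0 <-]]; exists (r + r').
  split; first exact: (submoduleD (s := I)).
    by rewrite rmorphD r0 r'0 addr0.
  exact: rmorphD.
have hZ a x : (exists r, [/\ I r, fib_fst r = 0 & fib_snd r = x]) ->
    exists r, [/\ I r, fib_fst r = 0 & fib_snd r = a * x].
  have [b <-] := fib_snd_surj a; move=> [r [Ir r0 <-]]; exists (b * r).
  split; first exact: (submoduleZ (s := I)).
    by rewrite rmorphM r0 mulr0.
  exact: rmorphM.
by exists (@Submodule T T^o _ h0 hD hZ).
Qed.

(** An ideal I of R is an extension of its image in S by its intersection with the kernel of R -> S,
    which is an ideal of T; lifts of generators of both generate I. *)
Lemma fib_noetherian : noetherian R.
Proof.
move=> I; have [IS ISE] := fib_fst_image I; have [IT ITE] := fib_snd_trace I.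
have [s sIS] := S_noeth IS; have [t tIT] := T_noeth IT.
have /choice[f fP] : forall x, exists r, x \in s -> I r /\ fib_fst r = x.
  move=> x; have [xs|] := boolP (x \in s); last by exists 0.
  have /ISE[r rP] : IS x by apply/sIS; exact: (@submod_span_sub _ S^o).
  by exists r.
have /choice[g gP] : forall y, exists r,
    y \in t -> [/\ I r, fib_fst r = 0 & fib_snd r = y].
  move=> y; have [yt|] := boolP (y \in t); last by exists 0.
  have /ITE[r rP] : IT y by apply/tIT; exact: (@submod_span_sub _ T^o).
  by exists r.
pose l := map f s ++ map g t; exists l => r.
have lI r' : gen_ideal l r' -> I r'.
  apply=> z; rewrite mem_cat => /orP[/mapP[x xs ->]|/mapP[y yt ->]].
    by have [] := fP x xs.
  by have [] := gP y yt.
split=> [Ir|/lI//].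
have [WS WSE] := fib_fst_image (gen_ideal l).
have [WT WTE] := fib_snd_trace (gen_ideal l).
(* [r'] matches r in the S-component, and [r''] then corrects the T-component alone. *)
have /WSE[r' [lr' rr']] : WS (fib_fst r).
  have /sIS : IS (fib_fst r) by apply/ISE; exists r.
  apply=> x xs; apply/WSE; exists (f x); split; last by have [] := fP x xs.
  by apply: (@submod_span_sub _ R^o); rewrite mem_cat map_f.
have /WTE[r'' [lr'' r''0 rr'']] : WT (fib_snd (r - r')).
  have /tIT : IT (fib_snd (r - r')).
    apply/ITE; exists (r - r'); split=> //; last by rewrite rmorphB rr' subrr.
    by apply: (@submoduleB _ R^o) => //; exact: lI.
  apply=> y yt; apply/WTE; exists (g y); have [_ gy1 gy2] := gP y yt.
  split=> //; apply: (@submod_span_sub _ R^o).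
  by rewrite mem_cat map_f ?orbT.
have -> : r = r' + r''.
  apply: fib_eq; rewrite rmorphD ?rr'' ?r''0 ?rr' ?addr0 //.
  by rewrite rmorphB addrC subrK.
exact: (@submoduleD _ R^o).
Qed.

Lemma fib_left_embed x : mS x -> exists r, fib_fst r = x /\ fib_snd r = 0.
Proof. by move=> /S_residue.2 x0; apply: fib_pair; rewrite x0 rmorph0. Qed.

Lemma fib_right_embed y : mT y -> exists r, fib_fst r = 0 /\ fib_snd r = y.
Proof. by move=> /T_residue.2 y0; apply: fib_pair; rewrite y0 rmorph0. Qed.

Lemma fib_res_eq0 r : fib_res r = 0 -> mS (fib_fst r) /\ mT (fib_snd r).
Proof.
by move=> r0; split; [apply/S_residue.2|apply/T_residue.2; rewrite -fib_resE].
Qed.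

Hypotheses (S_neq_k : exists x, mS x /\ x <> 0).
Hypotheses (T_neq_k : exists y, mT y /\ y <> 0).

(** The kernels of R -> T and R -> S are the copies of m_S and m_T, made of the pairs (x, 0) and (0,
    y). *)
Lemma fib_decomposes :
  decomposes fib_res (ker_ideal fib_snd) (ker_ideal fib_fst).
Proof.
split.
- by move=> r r2 r1; apply: fib_eq; rewrite rmorph0.
- move=> r /fib_res_eq0[/fib_left_embed[a [a1 a2]] _]; exists a.
  by split=> //; change (fib_fst (r - a) = 0); rewrite rmorphB a1 subrr.
- by move=> r r2; rewrite fib_resE r2 rmorph0.
- by move=> r r1; change (piS (fib_fst r) = 0); rewrite r1 rmorph0.
- split.
    have [x [/fib_left_embed[r [r1 r2]] x0]] := S_neq_k.
    by exists r; split=> // r0; apply: x0; rewrite -r1 r0 rmorph0.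
  have [y [/fib_right_embed[r [r1 r2]] y0]] := T_neq_k.
  by exists r; split=> // r0; apply: y0; rewrite -r2 r0 rmorph0.
Qed.

(** A nonzero s in m_S killed by m_S gives the pair (s, 0), killed by m_R; similarly for T. *)
Lemma fib_socle : has_depth mS 0 \/ has_depth mT 0 -> socle_nonzero fib_res.
Proof.
case=> [/(depth0_socle S_noeth S_local)/(_ S_neq_k)|].
  move=> [s [/fib_left_embed[r [r1 r2]] s0 ms]]; exists r; split.
  - by rewrite fib_resE r2 rmorph0.
  - by move=> r0; apply: s0; rewrite -r1 r0 rmorph0.
  - move=> r' /fib_res_eq0[r'S _]; apply: fib_eq; rewrite rmorphM rmorph0.
      by rewrite r1 mulrC ms.
    by rewrite r2 mul0r.
move=> /(depth0_socle T_noeth T_local)/(_ T_neq_k).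
move=> [s [/fib_right_embed[r [r1 r2]] s0 ms]]; exists r; split.
- by change (piS (fib_fst r) = 0); rewrite r1 rmorph0.
- by move=> r0; apply: s0; rewrite -r2 r0 rmorph0.
- move=> r' /fib_res_eq0[_ r'T]; apply: fib_eq; rewrite rmorphM rmorph0.
    by rewrite r1 mul0r.
  by rewrite r2 mulrC ms.
Qed.
End FiberProductRing.

Theorem theorem1p1
  (S T : comNzRingType) (k : fieldType)
  (mS : ideal S) (mT : ideal T)
  (piS : {rmorphism S -> k}) (piT : {rmorphism T -> k})
  (S_noeth : noetherian S) (T_noeth : noetherian T)
  (S_local : local_ring mS) (T_local : local_ring mT)
  (S_residue : residue_map mS piS) (T_residue : residue_map mT piT)
  (S_neq_k : exists x, mS x /\ x <> 0) (T_neq_k : exists y, mT y /\ y <> 0)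
  (M N : lmodType (fiber_product piS piT))
  (M_fg : fin_gen M) (N_fg : fin_gen N) :
  ((has_depth mS 0 \/ has_depth mT 0) ->
   (exists i, (5 <= i)%N /\ is_zero_module (Tor i M N)) ->
   is_free M \/ is_free N)
  /\
  ((exists i, [/\ (5 <= i)%N, is_zero_module (Tor i M N)
                & is_zero_module (Tor i.+1 M N)]) ->
   pd_le M 1 \/ pd_le N 1).
Proof.
have R_local := fib_local S_noeth T_noeth S_local T_local S_residue T_residue.
have R_noeth := fib_noetherian S_noeth T_noeth S_residue T_residue.
have R_dec := fib_decomposes S_residue T_residue S_neq_k T_neq_k.
(* The patterns discard degrees below 5; vanishing of Tor in degree i + 5 becomes [tor_zero] at
   index i + 4. *)
split=> [depth0 [[|[|[|[|[|i]]]]] [//] _ /Tor_tor_zero t]|].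
  apply: (tor_zero_socle R_local R_noeth R_dec) t => //.
  exact: fib_socle depth0.
move=> [[|[|[|[|[|i]]]]] [//] _ /Tor_tor_zero t /Tor_tor_zero t'].
exact: (tor_zero_consecutive R_local R_noeth R_dec _ _ t t').
Qed.
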